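(* Any tester for $\mathcal{T}(n,n,n,1/20)$ requires $\Omega(n^{7/4})$ samples.
   Context: For finite sets $\mathcal{X},\mathcal{Y},\mathcal{Z}$, a distribution $p$ on $\mathcal{X}\times\mathcal{Y}\times\mathcal{Z}$ of $(X,Y,Z)$ is conditionally independent if for all $(i,j,z)$, $\Pr[X=i,Y=j\mid Z=z]=\Pr[X=i\mid Z=z]\Pr[Y=j\mid Z=z]$; let $\mathcal{P}$ be the set of such distributions. $d_{TV}(p,q)=\frac12\sum_\omega|p(\omega)-q(\omega)|$, $d_{TV}(p,\mathcal{P})=\inf_{q\in\mathcal{P}}d_{TV}(p,q)$. The problem $\mathcal{T}(\ell_1,\ell_2,n,\varepsilon)$ with $|\mathcal{X}|=\ell_1,|\mathcal{Y}|=\ell_2,|\mathcal{Z}|=n$: given independent samples from unknown $p$ on $\mathcal{X}\times\mathcal{Y}\times\mathcal{Z}$, with probability at least $2/3$ accept if $p\in\mathcal{P}$ and reject if $d_{TV}(p,\mathcal{P})\ge\varepsilon$. *)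

(* Defs.v *)
From HB Require Import structures.
From mathcomp Require Import all_boot all_order all_algebra.
From mathcomp Require Import classical_sets reals exp.

Set Implicit Arguments.
Unset Strict Implicit.
Unset Printing Implicit Defensive.

Import Order.TTheory GRing.Theory Num.Theory.

Local Open Scope ring_scope.

Record distr (R : realType) (T : finType) := Distr {
  pmf :> T -> R;
  pmf_ge0 : forall w, 0 <= pmf w;
  pmf_sum1 : \sum_w pmf w = 1 }.

Definition Pr (R : realType) (T : finType) (p : distr R T) (A : pred T) : R :=
  \sum_(w | A w) p w.

Definition condPr (R : realType) (T : finType) (p : distr R T)
    (A B : pred T) : R :=
  Pr p [predI A & B] / Pr p B.

Definition dTV (R : realType) (T : finType) (p q : distr R T) : R :=
  2^-1 * \sum_w `|p w - q w|.

Definition dTV_set (R : realType) (T : finType) (p : distr R T)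
    (P : set (distr R T)) : R :=
  inf [set dTV p q | q in P]%classic.

(* A point w = ((i, j), z) of the product gives X = w.1.1, Y = w.1.2, Z = w.2.
   Conditioning on Z = z is only meaningful when Z = z has positive
   probability. *)
Definition cond_indep (R : realType) (X Y Z : finType)
    (p : distr R (X * Y * Z)%type) : Prop :=
  forall (i : X) (j : Y) (z : Z),
    0 < Pr p [pred w | w.2 == z] ->
    condPr p [pred w | (w.1.1 == i) && (w.1.2 == j)] [pred w | w.2 == z] =
    condPr p [pred w | w.1.1 == i] [pred w | w.2 == z] *
    condPr p [pred w | w.1.2 == j] [pred w | w.2 == z].

Definition CI (R : realType) (X Y Z : finType) :
    set (distr R (X * Y * Z)%type) :=
  [set p | cond_indep p]%classic.

(* A tester may be randomized: to each sequence of m samples it associates the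
   distribution of its verdict, true for accept and false for reject. *)
Definition tester (R : realType) (T : finType) (m : nat) :=
  m.-tuple T -> distr R bool.

Definition verdict_prob (R : realType) (T : finType) (m : nat)
    (D : tester R T m) (p : distr R T) (b : bool) : R :=
  \sum_(s : m.-tuple T) (\prod_(k < m) p (tnth s k)) * D s b.

Definition solves_CI_testing (R : realType) (X Y Z : finType) (eps : R)
    (m : nat) (D : tester R (X * Y * Z)%type m) : Prop :=
  forall p : distr R (X * Y * Z)%type,
    (cond_indep p -> 2 / 3 <= verdict_prob D p true) /\
    (eps <= dTV_set p (@CI R X Y Z) -> 2 / 3 <= verdict_prob D p false).

(* Main.v *)
(* Split the domains of X and Y into pairs of points, let Z be uniform, and in
   every slice let X pick a uniform pair with probability 1/2 (light) and one of
   w ~ n^(3/4) random heavy pairs otherwise, then a uniform point of the pair;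
   likewise for Y. The yes-instances are the resulting products. In the
   no-instances a light-light sample that falls in the block of pairs (i, j) is
   confined to one of the two diagonals of this 2 x 2 block, chosen by a random
   sign; since a diagonal is far from rank one, these are far from conditional
   independence. The samples reveal the difference only through collisions of
   light-light samples in one block, but heavy-heavy collisions are so much more
   frequent that the posterior probability of a collision being light is tiny.

   Quantitatively, expand the likelihood ratio of the two mixtures over the set
   B of samples whose sign is read off, and apply Parseval to the signs: the
   chi-square distance is a sum over the sets B that are perfectly matched within
   blocks, and each pair of the matching contributes at most
   (w / (2 k^2))^2, with k = n/2 pairs of points. With m samples there
   are about m w pairs of samples in a common slice, so the chi-square distance
   is of order m w^3 / n^4, which is small as long as m << n^(7/4). *)
Require Import Defs.
From HB Require Import structures.
From mathcomp Require Import all_boot all_order all_algebra.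
From mathcomp Require Import classical_sets reals exp.
From mathcomp Require Import fintype finset zify ring lra.

Set Implicit Arguments.
Unset Strict Implicit.
Unset Printing Implicit Defensive.

Import Order.TTheory GRing.Theory Num.Theory.

Local Open Scope ring_scope.

(** * Finite sums and characters *)

Section FiniteSums.
Variable R : realFieldType.

(** By induction, since [(1 + c) * (1 - c * (N + 1))] is at most [1 - c * N]. It replaces the
    exponential: when [c * N] is small, [(1 + c) ^+ N] is close to 1. *)
Lemma bernoulli_inv (c : R) (N : nat) :
  0 <= c -> (1 + c) ^+ N * (1 - c * N%:R) <= 1.
Proof.
move=> c0; elim: N => [|N IH]; first by rewrite expr0 mulr0 subr0 mulr1.
apply: le_trans IH; rewrite exprS -mulrA (mulrC (1 + c)) -!mulrA.
apply: ler_wpM2l; first by apply: exprn_ge0; lra.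
rewrite -natr1; have : 0 <= c ^+ 2 * N%:R + c ^+ 2 by rewrite addr_ge0 ?mulr_ge0 ?sqr_ge0.
nra.
Qed.

(** Weierstrass product inequality in relative form: if factor [i] loses at most the fraction [d i],
    the product loses at most the sum of these fractions. *)
Lemma weierstrass_prod (I : Type) (s : seq I) (P : pred I) (a a' d : I -> R) :
  (forall i, 0 <= a i) -> (forall i, 0 <= a' i) -> (forall i, 0 <= d i) ->
  (forall i, a i * (1 - d i) <= a' i) ->
  (\prod_(i <- s | P i) a i) * (1 - \sum_(i <- s | P i) d i)
    <= \prod_(i <- s | P i) a' i.
Proof.
move=> a0 a'0 d0 h; elim: s => [|x s IH]; first by rewrite !big_nil subr0 mulr1.
rewrite !big_cons; case: ifP => // _.
set p := \prod_(i <- s | P i) a i in IH *.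
set p' := \prod_(i <- s | P i) a' i in IH *.
set S := \sum_(i <- s | P i) d i in IH *.
have p0 : 0 <= p by apply: prodr_ge0.
have p'0 : 0 <= p' by apply: prodr_ge0.
have S0 : 0 <= S by apply: sumr_ge0.
(* Once the total loss reaches 1 the left side is nonpositive; below 1 every factor involved is
   nonnegative and can be multiplied. *)
have [dS|dS] := leP 1 (d x + S).
  apply: (@le_trans _ _ 0); last exact: mulr_ge0.
  by apply: mulr_ge0_le0; [exact: mulr_ge0|lra].
apply: (@le_trans _ _ (a x * (1 - d x) * (p * (1 - S)))).
  have -> : a x * (1 - d x) * (p * (1 - S)) =
    a x * p * ((1 - d x) * (1 - S)) by ring.
  apply: ler_wpM2l; first exact: mulr_ge0.
  by have := mulr_ge0 (d0 x) S0; nra.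
have d1 := d0 x.
apply: ler_pM => //; by apply: mulr_ge0 => //; lra.
Qed.

Lemma sum_ffun_pair (I A B : finType) (F : {ffun I -> A * B} -> R) :
  \sum_f F f = \sum_(g : {ffun I -> A}) \sum_(h : {ffun I -> B})
    F [ffun x => (g x, h x)].
Proof.
rewrite pair_big /=.
pose join (p : {ffun I -> A} * {ffun I -> B}) := [ffun x => (p.1 x, p.2 x)].
pose split (f : {ffun I -> A * B}) := ([ffun x => (f x).1], [ffun x => (f x).2]).
rewrite (reindex join) //=; exists split.
- by move=> [g h] _; congr (_, _); apply/ffunP => x; rewrite !ffunE.
- by move=> f _; apply/ffunP => x; rewrite !ffunE /= -surjective_pairing.
Qed.

(** * Resampling one value of a uniform random function *)

Section Update.
Variables A B : finType.

Definition upd (f : {ffun A -> B}) (x : A) (y : B) : {ffun A -> B} :=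
  [ffun a => if a == x then y else f a].

(** Each function with value [y] at [x] arises by this update from exactly [#|B|] functions. *)
Lemma sum_upd (F : {ffun A -> B} -> R) x y :
  \sum_f F (upd f x y) = #|B|%:R * \sum_(f : {ffun A -> B} | f x == y) F f.
Proof.
rewrite (partition_big (fun f : {ffun A -> B} => f x) predT) //=.
transitivity (\sum_(y' : B) \sum_(f : {ffun A -> B} | f x == y) F f); last first.
  by rewrite sumr_const mulr_natl.
apply: eq_bigr => y' _.
rewrite (reindex_onto (fun f => upd f x y') (fun f => upd f x y)) /=; last first.
  by move=> f /eqP <-; apply/ffunP => a; rewrite !ffunE; case: eqP => // ->.
have updK (f : {ffun A -> B}) : (upd (upd f x y') x y == f) = (f x == y).
  apply/eqP/eqP => [<-|<-]; first by rewrite ffunE eqxx.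
  by apply/ffunP => a; rewrite !ffunE; case: eqP => // ->.
under eq_bigl => f do rewrite ffunE eqxx eqxx updK /=.
by apply: eq_bigr => f; rewrite -updK => /eqP ->.
Qed.

(** As [F] ignores the value at [x], this value is uniform given all the others and hits [f x'] with
    probability [1 / #|B|]. *)
Lemma sum_collision (F : {ffun A -> B} -> R) x x' :
  x != x' -> (forall f y, F (upd f x y) = F f) ->
  #|B|%:R * \sum_(f : {ffun A -> B} | f x == f x') F f = \sum_f F f.
Proof.
move=> xx' Finv.
rewrite (partition_big (fun f : {ffun A -> B} => f x') predT) //=.
rewrite [RHS](partition_big (fun f : {ffun A -> B} => f x') predT) //=.
rewrite mulr_sumr; apply: eq_bigr => y _.
transitivity (#|B|%:R * \sum_(f : {ffun A -> B} | f x == y) (f x' == y)%:R * F f).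
  congr (_ * _); rewrite big_mkcond [RHS]big_mkcond; apply: eq_bigr => f _.
  case: (eqVneq (f x') y) => [->|_]; first by rewrite andbT mul1r.
  by rewrite andbF mul0r; case: ifP.
rewrite -(sum_upd (fun f => (f x' == y)%:R * F f)) [RHS]big_mkcond.
apply: eq_bigr => f _; rewrite Finv ffunE (eq_sym x' x) (negbTE xx').
by case: ifP; rewrite ?mul1r ?mul0r.
Qed.

End Update.

(** * Sign characters and Parseval's identity *)

Definition sgn (b : bool) : R := (-1) ^+ b.

Lemma sgnK b : sgn b * sgn b = 1.
Proof. by case: b; rewrite /sgn ?expr1 ?expr0 ?mulrNN mulr1. Qed.

Lemma sum_prod_sgn (I : finType) (B C : {set I}) :
  \sum_(u : {ffun I -> bool}) (\prod_(i in B) sgn (u i)) * (\prod_(i in C) sgn (u i))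
  = (B == C)%:R * 2 ^+ #|I|.
Proof.
pose F (i : I) (b : bool) :=
  (if i \in B then sgn b else 1) * (if i \in C then sgn b else 1).
transitivity (\sum_(u : {ffun I -> bool}) \prod_i F i (u i)).
  by apply: eq_bigr => u _; rewrite big_split /= -!big_mkcond.
rewrite -(bigA_distr_bigA (fun i b => F i b)).
case: (eqVneq B C) => [BC|/eqP BC] /=.
  rewrite mul1r -prodr_const; apply: eq_bigr => i _.
  by rewrite big_bool /F BC; case: (i \in C); rewrite ?sgnK ?mulr1.
(* A coordinate lying in exactly one of the two sets contributes the factor [1 + (-1)], which kills
   the product. *)
have /existsP[i iBC] : [exists i, (i \in B) != (i \in C)].
  apply: contra_notT BC; rewrite negb_exists => /forallP h.
  by apply/setP => i; apply/eqP; rewrite -[_ == _]negbK.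
rewrite mul0r (bigD1 i) //= big_bool /F /sgn.
move: iBC; case: (i \in B); case: (i \in C) => //= _.
all: by rewrite expr1 expr0 ?mulr1 ?mul1r addNr mul0r.
Qed.

Lemma parseval (I : finType) (c : {set I} -> R) :
  \sum_(u : {ffun I -> bool}) (\sum_B c B * \prod_(i in B) sgn (u i)) ^+ 2
  = 2 ^+ #|I| * \sum_B c B ^+ 2.
Proof.
transitivity (\sum_B \sum_C c B * c C * \sum_(u : {ffun I -> bool})
   (\prod_(i in B) sgn (u i)) * (\prod_(i in C) sgn (u i))).
  under eq_bigr => u _.
    rewrite expr2 big_distrlr /=.
    under eq_bigr => B _ do under eq_bigr => C _ do rewrite mulrACA.
    over.
  rewrite exchange_big; apply: eq_bigr => B _ /=.
  rewrite exchange_big; apply: eq_bigr => C _ /=.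
  by rewrite mulr_sumr.
rewrite mulr_sumr; apply: eq_bigr => B _.
rewrite (bigD1 B) //= sum_prod_sgn eqxx mul1r.
rewrite [X in _ + X]big1 => [|C CB]; first by rewrite addr0 mulrC expr2.
by rewrite sum_prod_sgn eq_sym (negbTE CB) mul0r mulr0.
Qed.

Lemma sum_subset_expr (I : finType) (P : {set I}) (c : R) :
  \sum_(M : {set I} | M \subset P) c ^+ #|M| = (1 + c) ^+ #|P|.
Proof.
rewrite -prodr_const [RHS]big_mkcond /=.
transitivity (\prod_i ((if i \in P then c else 0) + 1)); last first.
  by apply: eq_bigr => i _; case: ifP; rewrite ?add0r 1?addrC.
rewrite bigA_distr big_mkcond /=; apply: eq_bigr => M _.
case: ifP => [MP|/negbT].
  rewrite -prodr_const [LHS]big_mkcond; apply: eq_bigr => i _.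
  by case: ifP => // iM; rewrite (fintype.subsetP MP).
by case/subsetPn => i iM iP; rewrite (bigD1 i) //= iM (negbTE iP) mul0r.
Qed.

End FiniteSums.

(** * Reindexing sums over products *)

Section FiniteProducts.
Variable R : realFieldType.

Lemma sum_pair (A B : finType) (F : A * B -> R) :
  \sum_p F p = \sum_a \sum_b F (a, b).
Proof. by rewrite pair_bigA; apply: eq_bigr => -[]. Qed.

Lemma sum_latent (K Z : finType) (F : (K * bool) * (K * bool) * Z -> R) :
  \sum_l F l = \sum_z \sum_i \sum_j \sum_v \sum_u F ((i, u), (j, v), z).
Proof.
rewrite sum_pair exchange_big; apply: eq_bigr => z _ /=.
rewrite sum_pair sum_pair; apply: eq_bigr => i _.
by rewrite exchange_big sum_pair.
Qed.

Lemma sum_latent_ffun (K Z I : finType)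
    (F : {ffun I -> (K * bool) * (K * bool) * Z} -> R) :
  \sum_l F l = \sum_(z : {ffun I -> Z}) \sum_(i : {ffun I -> K})
    \sum_(j : {ffun I -> K}) \sum_(v : {ffun I -> bool}) \sum_(u : {ffun I -> bool})
    F [ffun p => ((i p, u p), (j p, v p), z p)].
Proof.
rewrite sum_ffun_pair exchange_big; apply: eq_bigr => z _ /=.
rewrite sum_ffun_pair sum_ffun_pair; apply: eq_bigr => i _.
rewrite exchange_big sum_ffun_pair; apply: eq_bigr => j _; apply: eq_bigr => v _.
apply: eq_bigr => u _; congr F; apply/ffunP => p.
by rewrite !ffunE.
Qed.

Lemma sum_inj (S T : finType) (f : S -> T) (F : T -> R) :
  injective f -> (forall t, 0 <= F t) -> \sum_s F (f s) <= \sum_t F t.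
Proof.
move=> fI F0; rewrite -(big_imset F (in2W fI)) /= big_mkcond.
by apply: ler_sum => t _; case: ifP.
Qed.

End FiniteProducts.

Lemma inj_of_card (A B : finType) : (#|A| <= #|B|)%N -> exists f : A -> B, injective f.
Proof.
move=> AB; exists (fun a => enum_val (widen_ord AB (enum_rank a))) => a b.
by move/enum_val_inj => /(congr1 val) /= /val_inj /enum_rank_inj.
Qed.

(** * Heavy slots explain collisions *)

Definition avg (R : realFieldType) (T : finType) (F : T -> R) : R :=
  #|T|%:R^-1 * \sum_t F t.

Section HeavySlots.
Variables (R : realFieldType) (Z W K : finType).
Hypotheses (K0 : (0 < #|K|)%N) (W0 : (0 < #|W|)%N).

Local Notation k := (#|K|%:R : R).
Local Notation w := (#|W|%:R : R).

Let k0 : 0 < k. Proof. by rewrite ltr0n. Qed.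
Let w0 : 0 < w. Proof. by rewrite ltr0n. Qed.

(** The law of the pair within slice [z]: half of the mass is uniform on [K], half is uniform on the
    slots [W]. Slots may share an image, so a heavy pair counts with multiplicity and the slots are
    independent. *)
Definition marg (phi : {ffun Z * W -> K}) (z : Z) (x : K) : R :=
  (2 * k)^-1 + (2 * w)^-1 * \sum_h (phi (z, h) == x)%:R.

Lemma marg_ge (phi : {ffun Z * W -> K}) z x : (2 * k)^-1 <= marg phi z x.
Proof.
by rewrite lerDl mulr_ge0 ?sumr_ge0 ?invr_ge0 ?mulr_ge0 // ltW.
Qed.

Lemma marg_gt0 (phi : {ffun Z * W -> K}) z x : 0 < marg phi z x.
Proof. by apply: lt_le_trans (marg_ge _ _ _); rewrite invr_gt0 mulr_gt0. Qed.

Lemma marg_sum (phi : {ffun Z * W -> K}) z : \sum_x marg phi z x = 1.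
Proof.
rewrite big_split /= sumr_const -mulr_sumr exchange_big /=.
have -> : \sum_h \sum_(x : K) (phi (z, h) == x)%:R = w.
  transitivity (\sum_(h : W) (1 : R)); last by rewrite sumr_const.
  apply: eq_bigr => h _; rewrite (bigD1 (phi (z, h))) //= eqxx big1 ?addr0 //.
  by move=> x /negbTE; rewrite eq_sym => ->.
rewrite -mulr_natl; field.
by rewrite !gt_eqF.
Qed.

(** The number of slots mapped to [x] is a natural number, hence at most its square. This makes the
    squared mass linear in the slots, so that a single slot explains a collision. *)
Lemma marg_sqr (phi : {ffun Z * W -> K}) z x :
  (4 * w ^+ 2)^-1 * \sum_h (phi (z, h) == x)%:R <= marg phi z x ^+ 2.
Proof.
rewrite /marg; set c := \sum_h _.
have [n cn] : exists n : nat, c = n%:R.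
  by exists (\sum_h (phi (z, h) == x))%N; rewrite natr_sum.
have cc : c <= c ^+ 2.
  rewrite cn; case: n {cn} => [|n]; first by rewrite expr0n.
  by rewrite -natrX ler_nat -mulnn leq_pmulr.
apply: (@le_trans _ _ (((2 * w)^-1 * c) ^+ 2)).
  have -> : ((2 * w)^-1 * c) ^+ 2 = (4 * w ^+ 2)^-1 * c ^+ 2.
    by field; rewrite gt_eqF.
  by rewrite ler_wpM2l // invr_ge0 mulr_ge0 ?sqr_ge0.
have c0 : 0 <= (2 * w)^-1 * c.
  by rewrite cn mulr_ge0 ?ler0n // invr_ge0 mulr_ge0 // ltW.
by rewrite ler_pXn2r ?nnegrE ?addr_ge0 // ?lerDr invr_ge0 mulr_ge0 // ltW.
Qed.

(** Redirecting slot [h] loses at most the term of [h] itself; a possible gain at [x] is dropped. *)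
Lemma marg_upd (phi : {ffun Z * W -> K}) z h x y :
  marg phi z y - (2 * w)^-1 * (phi (z, h) == y)%:R
  <= marg (upd phi (z, h) x) z y.
Proof.
rewrite /marg -addrA lerD2l -mulrBr.
apply: ler_wpM2l; first by rewrite invr_ge0 mulr_ge0 // ltW.
rewrite (bigD1 h) //= [leRHS](bigD1 h) //= addrAC subrr add0r.
rewrite -[leLHS]add0r lerD ?ler0n // le_eqVlt; apply/orP; left; apply/eqP.
apply: eq_bigr => h' hh'; rewrite ffunE xpair_eqE (negbTE hh') andbF //.
Qed.

Lemma marg_upd_neq (phi : {ffun Z * W -> K}) z z' h x y :
  z' != z -> marg (upd phi (z, h) x) z' y = marg phi z' y.
Proof.
move=> zz'; congr (_ + _ * _); apply: eq_bigr => h' _.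
by rewrite ffunE xpair_eqE (negbTE zz').
Qed.

Variables (I : finType) (z : I -> Z).

(** The factor of one coordinate in the term of [B] of the expanded likelihood: only samples outside
    [B] still depend on the heavy slots. *)
Definition residual (B : {set I}) (i : {ffun I -> K}) : R :=
  avg (fun phi : {ffun Z * W -> K} => \prod_(p | p \notin B) marg phi (z p) (i p)).

Let slots0 : 0 < #|{ffun Z * W -> K}|%:R :> R.
Proof.
by rewrite ltr0n card_ffun expn_gt0 K0.
Qed.

Lemma residual_gt0 B i : 0 < residual B i.
Proof.
case/card_gt0P: (W0) => h0 _; case/card_gt0P: (K0) => x0 _.
rewrite /residual /avg mulr_gt0 ?invr_gt0 //.
rewrite (bigD1 [ffun=> x0]) //= ltr_pwDl //.
  by apply: prodr_gt0 => p _; exact: marg_gt0.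
by apply: sumr_ge0 => f _; apply: prodr_ge0 => p _; exact/ltW/marg_gt0.
Qed.

Lemma residual_sum B : \sum_i residual B i = k ^+ #|B|.
Proof.
rewrite /residual /avg -mulr_sumr exchange_big /=.
transitivity (#|{ffun Z * W -> K}|%:R^-1 *
   \sum_(phi : {ffun Z * W -> K}) k ^+ #|B|); last first.
  by rewrite sumr_const -(mulr_natl (k ^+ _)) mulrA mulVf ?mul1r // gt_eqF.
congr (_ * _); apply: eq_bigr => phi _.
transitivity (\sum_(i : {ffun I -> K})
    \prod_p (if p \notin B then marg phi (z p) (i p) else 1)).
  by apply: eq_bigr => i _; rewrite big_mkcond.
rewrite -(bigA_distr_bigA (fun p x => if p \notin B then marg phi (z p) x else 1)).
rewrite -prodr_const [RHS]big_mkcond; apply: eq_bigr => p _.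
by case: (p \in B) => /=; rewrite ?marg_sum // sumr_const.
Qed.

(* A collision of two samples of the same slice is explained by a heavy slot
   [h]: resampling the image of [h] to be the common value [x] costs a factor
   [k^-1], and for a constant fraction of the slots it does not affect the
   other samples of the slice, because they occupy at most half of the slots. *)
Lemma residual_pair (B : {set I}) (i : {ffun I -> K}) p q :
  p != q -> p \in B -> q \in B -> z p = z q -> i p = i q ->
  (2 * #|[set r | z r == z p]| <= #|W|)%N ->
  (8 * w * k)^-1 * residual B i <= residual (B :\ p :\ q) i.
Proof.
move=> pq pB qB zpq ipq hw.
rewrite /residual /avg mulrCA ler_pM2l ?invr_gt0 //.
pose F (phi : {ffun Z * W -> K}) := \prod_(r | r \notin B) marg phi (z r) (i r).
have F0 phi : 0 <= F phi by apply: prodr_ge0 => r _; exact/ltW/marg_gt0.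
(* Taking [p] and [q] out of [B] restores two factors, which are equal because slice and pair
   agree. *)
have split phi : \prod_(r | r \notin B :\ p :\ q) marg phi (z r) (i r) =
    marg phi (z p) (i p) ^+ 2 * F phi.
  rewrite (bigD1 q) /=; last by rewrite !inE eqxx.
  rewrite (bigD1 p) /=; last by rewrite !inE eqxx pq ?andbF.
  rewrite mulrA -ipq -zpq -expr2; congr (_ * _); apply: eq_bigl => r.
  rewrite !inE; case: (eqVneq r p) => [->|] /=; first by rewrite pB ?andbF.
  by case: (eqVneq r q) => [->|] /=; rewrite ?qB ?andbF ?andbT.
have main phi : w / 2 * F phi <= \sum_h F (upd phi (z p, h) (i p)).
  (* The fraction that the factor of sample [r] can lose when slot [h] of the slice is
     redirected. *)
  pose d h r := if z r == z p
    then (2 * w * marg phi (z r) (i r))^-1 * (phi (z r, h) == i r)%:R else 0.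
  have d0 h r : 0 <= d h r.
    rewrite /d; case: ifP => // _; rewrite mulr_ge0 ?ler0n // invr_ge0.
    by rewrite !mulr_ge0 ?ltW // marg_gt0.
  apply: (@le_trans _ _ (\sum_h F phi * (1 - \sum_(r | r \notin B) d h r))).
    rewrite -mulr_sumr mulrC ler_wpM2l // big_split /= sumrN sumr_const.
    rewrite exchange_big /=.
    (* Over all slots one sample loses at most 1 in total, because the heavy part of [marg] is at
       most [marg]. The slice has at most [w / 2] samples, so at least [w / 2] remains of the sum
       over [h]. *)
    have : \sum_(r | r \notin B) \sum_h d h r <= \sum_(r in [set r | z r == z p]) 1.
      rewrite big_mkcond [leRHS]big_mkcond; apply: ler_sum => r _.
      rewrite inE /d; case: ifP => _; last by case: ifP.
      case: ifP => _; last by rewrite big1.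
      rewrite -mulr_sumr; have m0 := marg_gt0 phi (z r) (i r).
      rewrite ler_pdivrMl ?mulr_gt0 // mulr1 -ler_pdivrMl ?mulr_gt0 //.
      by rewrite /marg lerDr invr_ge0 mulr_ge0 // ltW.
    rewrite sumr_const => hs.
    have : 2 * #|[set r | z r == z p]|%:R <= w by rewrite -natrM ler_nat.
    by move: hs; set x := \sum_(r | _) _; lra.
  apply: ler_sum => h _; apply: weierstrass_prod => // r.
  - exact/ltW/marg_gt0.
  - exact/ltW/marg_gt0.
  - have m0 := marg_gt0 phi (z r) (i r).
    rewrite /d; case: eqP => [e|/eqP e]; last by rewrite subr0 mulr1 marg_upd_neq.
    rewrite -e; apply: le_trans (marg_upd _ _ _ _ _).
    rewrite le_eqVlt; apply/orP; left; apply/eqP.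
    by field; rewrite !gt_eqF.
under [leRHS]eq_bigr => phi _ do rewrite split.
apply: (@le_trans _ _ (\sum_(phi : {ffun Z * W -> K})
   (4 * w ^+ 2)^-1 * \sum_h (phi (z p, h) == i p)%:R * F phi)); last first.
  apply: ler_sum => phi _; rewrite -mulr_suml mulrA.
  by rewrite ler_wpM2r // marg_sqr.
rewrite -[leRHS]mulr_sumr exchange_big /=.
have -> : \sum_h \sum_(phi : {ffun Z * W -> K}) (phi (z p, h) == i p)%:R * F phi
   = k^-1 * \sum_(phi : {ffun Z * W -> K}) \sum_h F (upd phi (z p, h) (i p)).
  rewrite [in RHS]exchange_big mulr_sumr; apply: eq_bigr => h _ /=.
  rewrite sum_upd mulrA mulVf ?gt_eqF // mul1r [RHS]big_mkcond.
  by apply: eq_bigr => phi _; case: ifP; rewrite ?mul1r ?mul0r.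
apply: (@le_trans _ _ ((4 * w ^+ 2)^-1 * (k^-1 *
  \sum_(phi : {ffun Z * W -> K}) (w / 2 * F phi)))).
  rewrite -mulr_sumr -/F; set S := \sum_(_ : {ffun _}) _.
  rewrite le_eqVlt; apply/orP; left; apply/eqP.
  by field; rewrite !gt_eqF.
rewrite ler_wpM2l ?invr_ge0 ?mulr_ge0 ?sqr_ge0 // ler_wpM2l ?invr_ge0 ?(ltW k0) //.
by apply: ler_sum => phi _; exact: main.
Qed.

End HeavySlots.

(** * Matchings and the chi-square distance *)

Section Matchings.
Variables (R : realFieldType) (I : finType).

(** Endpoints are kept with multiplicity, so [uniq (ends s)] says that [s] is a matching: disjoint
    pairs of distinct points. *)
Definition ends (s : seq (I * I)) : seq I :=
  flatten [seq [:: x.1; x.2] | x <- s].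

Definition matched (C : eqType) (g : I -> C) (s : seq (I * I)) : bool :=
  all (fun x => g x.1 == g x.2) s.

Lemma size_ends s : size (ends s) = (2 * size s)%N.
Proof. by elim: s => //= x s ->; rewrite mulnS. Qed.

Lemma card_ends s : uniq (ends s) -> #|[set p in ends s]| = (2 * size s)%N.
Proof. by move=> us; rewrite cardsE (card_uniqP us) size_ends. Qed.

Lemma uniq_pairs s : uniq (ends s) -> uniq s.
Proof.
elim: s => //= x s IH /andP[_ /andP[xs us]]; rewrite IH // andbT.
apply: contra xs => xs; apply/flattenP; exists [:: x.1; x.2].
  exact: (map_f (fun x : I * I => [:: x.1; x.2])).
by rewrite !inE eqxx orbT.
Qed.

Lemma perm_ends s t : perm_eq s t -> perm_eq (ends s) (ends t).
Proof. by move=> st; apply/perm_flatten/perm_map. Qed.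

Lemma setD_ends (x : I * I) s : uniq (ends (x :: s)) ->
  [set p in ends (x :: s)] :\ x.1 :\ x.2 = [set p in ends s].
Proof.
move=> /= /andP[x1 /andP[x2 _]]; apply/setP => p; rewrite !inE /=.
case: (eqVneq p x.2) => [->|_] /=; first by rewrite (negbTE x2).
case: (eqVneq p x.1) => [->|_] //=.
by move: x1; rewrite inE negb_or => /andP[_ /negbTE ->].
Qed.

Section Signs.
Variables (C : finType) (c : I -> C).

(** Equal to 1 if every cell of [c] contains an even number of points of [B], and to 0 otherwise. *)
Definition sign_avg (B : {set I}) : R :=
  avg (fun tau : {ffun C -> bool} => \prod_(p in B) sgn R (tau (c p))).

Lemma norm_sgn b : `|sgn R b| = 1.
Proof. by case: b; rewrite /sgn ?expr1 ?expr0 ?normrN1 ?normr1. Qed.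

Lemma sign_avg_sqr_le1 B : sign_avg B ^+ 2 <= 1.
Proof.
have t0 : 0 < #|{ffun C -> bool}|%:R :> R.
  by rewrite ltr0n card_ffun expn_gt0 card_bool.
rewrite -[_ ^+ 2]ger0_norm ?sqr_ge0 // normrX exprn_ile1 // /sign_avg /avg normrM.
rewrite ger0_norm ?invr_ge0 ?ler0n // ler_pdivrMl // mulr1.
apply: le_trans (ler_norm_sum _ _ _) _.
rewrite -[leRHS]sumr_const; apply: ler_sum => tau _.
by rewrite normr_prod big1 // => p _; rewrite norm_sgn.
Qed.

(** If [p] were alone in its cell, flipping the sign of that cell would negate every summand and the
    average would vanish. *)
Lemma sign_avg_partner (B : {set I}) p :
  sign_avg B != 0 -> p \in B -> exists q, [/\ q \in B, q != p & c q = c p].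
Proof.
move=> + pB; case: (pickP [pred q | [&& q \in B, q != p & c q == c p]]).
  by move=> q /= /and3P[qB qp /eqP cq] _; exists q.
move=> none /negP[]; rewrite mulf_eq0; apply/orP; right.
pose flip (tau : {ffun C -> bool}) := upd tau (c p) (~~ tau (c p)).
have flipK : involutive flip.
  move=> tau; apply/ffunP => d; rewrite !ffunE eqxx negbK.
  by case: eqP => // ->.
set S := \sum_tau _; have : S = - S; last by move=> e; apply/eqP; lra.
rewrite {1}/S (reindex_inj (inv_inj flipK)) -sumrN; apply: eq_bigr => tau _.
rewrite (bigD1 p) //= [in RHS](bigD1 p) //= -mulNr; congr (_ * _).
  by rewrite !ffunE eqxx /sgn; case: (tau (c p)); rewrite ?opprK.
apply: eq_bigr => q /andP[qB qp]; rewrite !ffunE.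
by have := none q; rewrite /= qB qp /= => ->.
Qed.

Lemma sign_avgD (B : {set I}) p q : p != q -> p \in B -> q \in B -> c p = c q ->
  sign_avg B = sign_avg (B :\ p :\ q).
Proof.
move=> pq pB qB cpq; congr (_ * _); apply: eq_bigr => tau _.
rewrite (bigD1 p) //= (bigD1 q) /= ?qB 1?eq_sym // -cpq mulrA sgnK mul1r.
by apply: eq_bigl => r; rewrite !inE; case: (r \in B); case: (r == p); case: (r == q).
Qed.

(** Match a point with a partner in its cell, remove both, which leaves the average unchanged
    because their signs cancel, and recurse. *)
Lemma sign_avg_matching B : sign_avg B != 0 ->
  exists s, [/\ uniq (ends s), [set p in ends s] = B & matched c s].
Proof.
have [n] := ubnP #|B|; elim: n => // n IH in B * => cardB sB.
have [->|/set0Pn[p pB]] := eqVneq B set0.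
  by exists [::]; split => //; apply/setP => p; rewrite !inE.
have [q [qB qp cqp]] := sign_avg_partner sB pB.
have pq : p != q by rewrite eq_sym.
have qB' : q \in B :\ p by rewrite !inE qp.
have [||s [us es ms]] := IH (B :\ p :\ q).
- move: cardB; rewrite (cardsD1 p) pB (cardsD1 q (B :\ p)) qB' /=.
  by rewrite !add1n !ltnS => /ltnW.
- by rewrite -sign_avgD.
have ends_s r : r \in ends s = [&& r != q, r != p & r \in B].
  by have /setP/(_ r) := es; rewrite !inE.
exists ((p, q) :: s); split.
- by rewrite /= inE (negbTE pq) !ends_s eqxx /= !eqxx /= andbF us.
- apply/setP => r; rewrite !inE -/(ends s) ends_s.
  case: (eqVneq r p) => [->|] /=; first by rewrite pB.
  by case: (eqVneq r q) => [->|] /=; rewrite ?qB.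
- by rewrite /matched /= cqp eqxx.
Qed.

End Signs.

(** The pairs are disjoint and [F] ignores their endpoints, so the collisions are independent events
    of probability [1 / #|K|]. *)
Lemma sum_matched (K : finType) (s : seq (I * I)) (F : {ffun I -> K} -> R) :
  uniq (ends s) -> (forall f p y, p \in ends s -> F (upd f p y) = F f) ->
  #|K|%:R ^+ size s * \sum_(f : {ffun I -> K} | matched f s) F f = \sum_f F f.
Proof.
elim: s F => [|x s IH] F; first by move=> _ _; rewrite expr0 mul1r.
move=> us Finv; have := us => /= /andP[x1 /andP[x2 us']].
move: x1; rewrite inE negb_or => /andP[x12 x1].
rewrite -[RHS](sum_collision x12) => [|f y]; last by rewrite Finv ?inE ?eqxx.
(* The induction hypothesis is applied to [F] times the indicator of a collision at [x], which
   ignores the endpoints of [s] by disjointness. *)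
rewrite [in RHS]big_mkcond -IH //=; last first.
  move=> f p y ps; rewrite !ffunE Finv ?inE ?ps ?orbT //.
  case: (eqVneq x.1 p) x1 => [->|_ _]; first by rewrite ps.
  by case: (eqVneq x.2 p) x2 => [->|//]; rewrite ps.
rewrite exprS mulrA; congr (_ * _).
by rewrite -big_mkcondr; apply: eq_bigl => f; rewrite andbC.
Qed.

End Matchings.

(** * Chi-square weights of matched sets of samples *)

Section ChiSquare.
Variables (R : realFieldType) (Z W K : finType).
Hypotheses (K0 : (0 < #|K|)%N) (W0 : (0 < #|W|)%N).
Variables (I : finType) (z : I -> Z).
Hypothesis slices : forall q, (2 * #|[set r | z r == q]| <= #|W|)%N.

Local Notation k := (#|K|%:R : R).
Local Notation w := (#|W|%:R : R).
Local Notation res := (residual R W z).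

Let k0 : 0 < k. Proof. by rewrite ltr0n. Qed.
Let w0 : 0 < w. Proof. by rewrite ltr0n. Qed.

Lemma residual_matched (s : seq (I * I)) (i : {ffun I -> K}) :
  uniq (ends s) -> matched z s -> matched i s ->
  (8 * w * k)^-1 ^+ size s * res [set p in ends s] i <= res set0 i.
Proof.
elim: s => [|x s IH].
  move=> _ _ _; rewrite expr0 mul1r le_eqVlt; apply/orP; left; apply/eqP.
  by congr residual; apply/setP => p; rewrite !inE.
move=> us /= /andP[/eqP zx zs] /andP[/eqP ix is_].
have := us => /= /andP[x1 /andP[_ us']].
apply: le_trans (IH us' zs is_); rewrite exprSr -mulrA.
apply: ler_wpM2l; first by rewrite exprn_ge0 // invr_ge0 !mulr_ge0 // ltW.
rewrite -(setD_ends us); apply: residual_pair => //.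
- by move: x1; rewrite inE negb_or => /andP[].
- by rewrite !inE eqxx.
- by rewrite !inE eqxx orbT.
Qed.

(** The share of one coordinate in the chi-square term of [B]: the squared coefficient over the null
    density splits into one such weight for X and one for Y. *)
Definition chi_weight (B : {set I}) (i : {ffun I -> K}) : R :=
  (2 * k) ^- (2 * #|B|) * (res B i ^+ 2 / res set0 i).

Lemma chi_weight_ge0 B i : 0 <= chi_weight B i.
Proof.
apply: mulr_ge0; first by rewrite invr_ge0 exprn_ge0 // mulr_ge0 // ltW.
by apply: divr_ge0; rewrite ?sqr_ge0 // ltW // residual_gt0.
Qed.

Lemma residual_upd (B : {set I}) (i : {ffun I -> K}) p y :
  p \in B -> res B (upd i p y) = res B i.
Proof.
move=> pB; congr (_ * _); apply: eq_bigr => phi _; apply: eq_bigr => q qB.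
by rewrite ffunE; case: eqP qB => // ->; rewrite pB.
Qed.

(** One of the two factors [res B i] is traded for [res set0 i] at the price [8 * w * k] per pair.
    The sum left is linear in the residual and equals [k ^+ size s], since of the [2 * size s] free
    choices half are fixed by the collisions. *)
Lemma sum_chi_weight (s : seq (I * I)) :
  uniq (ends s) -> matched z s ->
  \sum_(i : {ffun I -> K} | matched i s) chi_weight [set p in ends s] i
  <= (w / (2 * k ^+ 2)) ^+ size s.
Proof.
move=> us zs; set B := [set p in ends s].
have BE : #|B| = (2 * size s)%N by exact: card_ends.
apply: (@le_trans _ _ (\sum_(i : {ffun I -> K} | matched i s)
   (2 * k) ^- (2 * #|B|) * ((8 * w * k) ^+ size s * res B i))).
  apply: ler_sum => i is_; apply: ler_wpM2l.
    by rewrite invr_ge0 exprn_ge0 // mulr_ge0 // ltW.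
  have wk : 0 < 8 * w * k by rewrite !mulr_gt0.
  have := residual_matched us zs is_; rewrite -/B exprVn.
  have := residual_gt0 R K0 W0 z B i; have := residual_gt0 R K0 W0 z set0 i.
  set x := res B i; set y := res set0 i => y0 x0.
  rewrite mulrC ler_pdivrMr ?exprn_gt0 // => xy.
  rewrite ler_pdivrMr // expr2.
  have -> : (8 * w * k) ^+ size s * x * y = y * (8 * w * k) ^+ size s * x by ring.
  by rewrite ler_pM2r.
have := @sum_matched R I K s (res B) us.
rewrite residual_sum // BE => /(_ _)-hs.
rewrite -mulr_sumr -mulr_sumr.
have -> : \sum_(i : {ffun I -> K} | matched i s) res B i = k ^+ size s.
  apply: (mulfI (_ : k ^+ size s != 0)); first by rewrite expf_neq0 // gt_eqF.
  rewrite hs => [|f p y ps]; first by rewrite -exprD addnn mul2n.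
  by rewrite residual_upd // inE.
rewrite le_eqVlt; apply/orP; left; apply/eqP.
rewrite -exprMn mulnA exprM -exprVn -exprMn; congr (_ ^+ _).
by field; rewrite gt_eqF.
Qed.

(** A union bound over matchings: every contributing [B] is the set of endpoints of a matching [M]
    inside slices, and [M] contributes at most [c ^+ #|M|] for each of X and Y. Summing over all
    subsets of [P] gives a power of [1 + c ^+ 2], and the empty matching accounts for the [- 1]. *)
Lemma chi_square_bound (T : nat) :
  (forall q, #|[set r | z r == q]| <= T)%N ->
  \sum_(i : {ffun I -> K}) \sum_(j : {ffun I -> K}) \sum_(B | B != set0)
     sign_avg R (fun p => (z p, i p, j p)) B ^+ 2 *
     (chi_weight B i * chi_weight B j)
  <= (1 + (w / (2 * k ^+ 2)) ^+ 2) ^+ (#|I| * T) - 1.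
Proof.
move=> hT; set c := w / _.
have c0 : 0 <= c by rewrite divr_ge0 ?mulr_ge0 ?exprn_ge0 // ltW.
pose P := [set x : I * I | z x.1 == z x.2].
pose good (M : {set I * I}) (i j : {ffun I -> K}) :=
  [&& uniq (ends (enum M)), matched z (enum M), matched i (enum M)
    & matched j (enum M)].
pose cov (M : {set I * I}) : {set I} := [set p in ends (enum M)].
have PT : (#|P| <= #|I| * T)%N.
  rewrite -sum1_card (eq_bigl (fun x => predT x.1 && (z x.1 == z x.2))); last first.
    by move=> x; rewrite inE.
  rewrite -(pair_big_dep predT (fun p q => z p == z q) (fun _ _ => 1%N)) /=.
  rewrite -sum_nat_const; apply: leq_sum => p _.
  by rewrite sum1_card -(cardsE) -(eq_card (in_set _)) (leq_trans _ (hT (z p))) //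
     subset_leq_card //; apply/fintype.subsetP => q; rewrite !inE eq_sym.
(* The term of [B] is charged to all matchings that cover exactly [B]; at least one exists when the
   sign average is nonzero. *)
have step (i j : {ffun I -> K}) (B : {set I}) : B != set0 ->
  sign_avg R (fun p => (z p, i p, j p)) B ^+ 2 *
     (chi_weight B i * chi_weight B j)
  <= \sum_(M : {set I * I} | [&& M \subset P, M != set0, good M i j & cov M == B])
       chi_weight B i * chi_weight B j.
  move=> B0; have X0 : 0 <= chi_weight B i * chi_weight B j.
    by rewrite mulr_ge0 ?chi_weight_ge0.
  have [->|sB] := eqVneq (sign_avg R (fun p => (z p, i p, j p)) B) 0.
    by rewrite expr0n mul0r sumr_ge0.
  apply: (@le_trans _ _ (chi_weight B i * chi_weight B j)).
    by rewrite -[leRHS]mul1r ler_wpM2r // sign_avg_sqr_le1.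
  have [s [us es ms]] := sign_avg_matching sB.
  have ps : perm_eq (enum [set x in s]) s.
    apply: uniq_perm; rewrite ?enum_uniq ?uniq_pairs // => x.
    by rewrite mem_enum inE.
  have sub (C : eqType) (g : I -> C) : (forall p q, z p = z q -> i p = i q ->
      j p = j q -> g p = g q) -> matched g (enum [set x in s]).
    move=> hg; rewrite /matched (perm_all _ ps); apply/allP => x xs.
    by have /allP/(_ x xs)/eqP[zx ix jx] := ms; apply/eqP/hg.
  rewrite (bigD1 [set x in s]) /= ?lerDl ?sumr_ge0 //.
  apply/and4P; split.
  - apply/fintype.subsetP => x; rewrite !inE => xs.
    by have /allP/(_ x xs)/eqP[-> _ _] := ms.
  - apply: contra B0 => /eqP s0; rewrite -es; apply/eqP/setP => p; rewrite !inE.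
    case: s s0 {us es ms ps sub} => // x s /setP/(_ x).
    by rewrite !inE eqxx.
  - by rewrite /good (perm_uniq (perm_ends ps)) us !sub.
  - apply/eqP; rewrite -es; apply/setP => p; rewrite !inE.
    exact: perm_mem (perm_ends ps) p.
apply: (@le_trans _ _ (\sum_(M : {set I * I} | M \subset P :\: set0)
   (c ^+ 2) ^+ #|M| - 1)); last first.
  rewrite setD0 sum_subset_expr lerD2r ler_weXn2l // lerDl sqr_ge0 //.
rewrite setD0 (bigD1 set0) ?sub0set //= cards0 expr0 [leRHS]addrAC subrr add0r.
apply: (@le_trans _ _ (\sum_(M : {set I * I} | (M \subset P) && (M != set0))
   \sum_(i : {ffun I -> K}) \sum_(j : {ffun I -> K} | good M i j)
     chi_weight (cov M) i * chi_weight (cov M) j)).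
  rewrite [leRHS]exchange_big; apply: ler_sum => i _ /=.
  under [leRHS]eq_bigr => M _ do rewrite big_mkcond.
  rewrite [leRHS]exchange_big; apply: ler_sum => j _ /=.
  apply: le_trans (ler_sum _ (fun B hB => step i j B hB)) _.
  rewrite (exchange_big_dep (fun M : {set I * I} => (M \subset P) && (M != set0))) /=;
    last by move=> B M _ /and4P[-> ->].
  apply: ler_sum => M /andP[MP M0]; rewrite MP M0 /=.
  case: ifP => gM /=; last by rewrite big_pred0 // => B; rewrite andbF.
  have X0 : 0 <= chi_weight (cov M) i * chi_weight (cov M) j.
    by rewrite mulr_ge0 ?chi_weight_ge0.
  rewrite (eq_bigr (fun _ => chi_weight (cov M) i * chi_weight (cov M) j));
    last by move=> B /andP[_ /eqP <-].
  rewrite big_mkcond (bigD1 (cov M)) //= eqxx andbT big1 ?addr0.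
    by case: ifP.
  by move=> B; rewrite eq_sym => /negbTE ->; rewrite andbF.
apply: ler_sum => M /andP[MP M0].
have [/andP[uM zM]|bad] := boolP (uniq (ends (enum M)) && matched z (enum M)); last first.
  rewrite big1 ?exprn_ge0 ?sqr_ge0 // => i _; rewrite big_pred0 // => j.
  by rewrite /good andbA (negbTE bad).
rewrite /good uM zM /= cardE exprAC expr2.
have := sum_chi_weight uM zM; rewrite -/c -/(cov M).
set S := \sum_(i | _) _ => hS.
have S0 : 0 <= S by apply: sumr_ge0 => i _; exact: chi_weight_ge0.
(* For a fixed matching the conditions on [i] and [j] are separate, so the double sum is a
   product. *)
apply: (@le_trans _ _ (S * S)); last exact: ler_pM.
rewrite /S big_distrlr /= [leRHS]big_mkcond; apply: ler_sum => i _.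
by case: (matched i _) => //=; rewrite big_pred0.
Qed.

End ChiSquare.

(** * The two mixtures *)

Section Averages.
Variables (R : realFieldType) (T : finType).

Lemma avg_const (c : R) : (0 < #|T|)%N -> avg (fun _ : T => c) = c.
Proof.
move=> T0; rewrite /avg sumr_const -(mulr_natl c) mulrA mulVf ?mul1r //.
by rewrite pnatr_eq0 -lt0n.
Qed.

Lemma avg_sum (J : finType) (F : T -> J -> R) :
  avg (fun t => \sum_j F t j) = \sum_j avg (F^~ j).
Proof. by rewrite /avg exchange_big mulr_sumr. Qed.

Lemma avgZ (c : R) (F : T -> R) : avg (fun t => c * F t) = c * avg F.
Proof. by rewrite /avg -mulr_sumr mulrCA. Qed.

Lemma eq_avg (F G : T -> R) : (forall t, F t = G t) -> avg F = avg G.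
Proof. by move=> FG; congr (_ * _); apply: eq_bigr => t _; rewrite FG. Qed.

Lemma le_avg (F G : T -> R) : (forall t, F t <= G t) -> avg F <= avg G.
Proof. by move=> FG; rewrite ler_wpM2l ?invr_ge0 ?ler0n // ler_sum. Qed.

Lemma avg_ge0 (F : T -> R) : (forall t, 0 <= F t) -> 0 <= avg F.
Proof. by move=> F0; rewrite mulr_ge0 ?invr_ge0 ?ler0n // sumr_ge0. Qed.

End Averages.

(** Independence of the heavy slots of X, those of Y and the signs: the expectation of each product
    factors. *)
Lemma avg_sum_prod (R : realFieldType) (J T1 T2 T3 : finType) (c : J -> R)
    (S : J -> T3 -> R) (F : J -> T1 -> R) (G : J -> T2 -> R) :
  avg (fun x => avg (fun y => avg (fun t => \sum_b c b * (S b t * F b x * G b y))))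
  = \sum_b c b * (avg (S b) * avg (F b) * avg (G b)).
Proof.
transitivity (avg (fun x => \sum_b c b * avg (S b) * avg (G b) * F b x)).
  apply: eq_avg => x.
  transitivity (avg (fun y => \sum_b c b * avg (S b) * F b x * G b y)).
    apply: eq_avg => y; rewrite avg_sum; apply: eq_bigr => b _.
    rewrite -[RHS](_ : (c b * F b x * G b y) * avg (S b) = _); last by ring.
    by rewrite -avgZ; apply: eq_avg => t; ring.
  rewrite avg_sum; apply: eq_bigr => b _; rewrite avgZ; ring.
rewrite avg_sum; apply: eq_bigr => b _; rewrite avgZ; ring.
Qed.

(** * Expansion and comparison of the mixtures *)

Section Mixtures.
Variables (R : realFieldType) (Z W K I : finType).
Hypotheses (K0 : (0 < #|K|)%N) (W0 : (0 < #|W|)%N) (Z0 : (0 < #|Z|)%N).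

Local Notation k := (#|K|%:R : R).
Local Notation w := (#|W|%:R : R).
Local Notation n := (#|Z|%:R : R).
Local Notation heavy := {ffun Z * W -> K}.
Local Notation signs := {ffun Z * K * K -> bool}.

Let k0 : 0 < k. Proof. by rewrite ltr0n. Qed.
Let w0 : 0 < w. Proof. by rewrite ltr0n. Qed.
Let n0 : 0 < n. Proof. by rewrite ltr0n. Qed.

(* A latent point ((x, u), (y, v), z) stands for the point u of the pair x, the
   point v of the pair y, and the slice z. *)
Definition inst (beta : bool) (phi psi : heavy) (tau : signs)
    (l : (K * bool) * (K * bool) * Z) : R :=
  (4 * n)^-1 *
  (beta%:R * (4 * k ^+ 2)^-1 *
     (sgn R l.1.2.2 * (sgn R l.1.1.2 * sgn R (tau (l.2, l.1.1.1, l.1.2.1)))) +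
   marg R phi l.2 l.1.1.1 * marg R psi l.2 l.1.2.1).

Definition mixture (beta : bool) (z : {ffun I -> Z}) (i j : {ffun I -> K})
    (v u : {ffun I -> bool}) : R :=
  avg (fun phi : heavy => avg (fun psi : heavy => avg (fun tau : signs =>
    \prod_p inst beta phi psi tau ((i p, u p), (j p, v p), z p)))).

Definition parity (B : {set I}) (u : {ffun I -> bool}) : R :=
  \prod_(p in B) sgn R (u p).

(** Multiply out the product over the samples: [B] collects those from which the sign term of [inst]
    is taken, the others contribute the product of the marginals. *)
Lemma mixtureE beta z i j v u :
  mixture beta z i j v u = (4 * n) ^- #|I| *
    \sum_(B : {set I}) (beta%:R / (4 * k ^+ 2)) ^+ #|B| *
      (sign_avg R (fun p => (z p, i p, j p)) B *
       residual R W z B i * residual R W z B j) * parity B v * parity B u.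
Proof.
pose c (B : {set I}) : R := (4 * n) ^- #|I| * ((beta%:R / (4 * k ^+ 2)) ^+ #|B|
  * parity B v * parity B u).
transitivity (avg (fun phi : heavy => avg (fun psi : heavy => avg (fun tau : signs =>
  \sum_(B : {set I}) c B * (\prod_(p in B) sgn R (tau (z p, i p, j p)) *
   (\prod_(p | p \notin B) marg R phi (z p) (i p)) *
   (\prod_(p | p \notin B) marg R psi (z p) (j p))))))).
  apply: eq_avg => phi; apply: eq_avg => psi; apply: eq_avg => tau.
  rewrite big_split /= prodr_const exprVn bigA_distr mulr_sumr.
  apply: eq_bigr => B _; rewrite /c -!mulrA; congr (_ * _).
  rewrite (bigID (mem B)) /=.
  rewrite (eq_bigr (fun p => beta%:R / (4 * k ^+ 2) * (sgn R (v p) *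
    (sgn R (u p) * sgn R (tau (z p, i p, j p)))))); last first.
    by move=> p -> /=.
  rewrite [X in _ * X = _](eq_bigr (fun p =>
    marg R phi (z p) (i p) * marg R psi (z p) (j p))); last first.
    by move=> p /negbTE -> /=.
  by rewrite !big_split /= !prodr_const /parity exprMn -!mulrA.
rewrite (avg_sum_prod c
  (fun B (tau : signs) => \prod_(p in B) sgn R (tau (z p, i p, j p)))
  (fun B (phi : heavy) => \prod_(p | p \notin B) marg R phi (z p) (i p))
  (fun B (psi : heavy) => \prod_(p | p \notin B) marg R psi (z p) (j p))).
rewrite mulr_sumr; apply: eq_bigr => B _; rewrite /c.
rewrite -/(sign_avg R (fun p => (z p, i p, j p)) B).
rewrite -/(residual R W z B i) -/(residual R W z B j).
by ring.
Qed.

Lemma parity0 u : parity set0 u = 1.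
Proof. by rewrite /parity big_set0. Qed.

Lemma mixture_null z i j v u : mixture false z i j v u =
  (4 * n) ^- #|I| * (residual R W z set0 i * residual R W z set0 j).
Proof.
rewrite mixtureE (bigD1 set0) //= big1 => [|B B0]; last first.
  by rewrite mul0r expr0n cards_eq0 (negbTE B0) !mul0r.
have -> : sign_avg R (fun p => (z p, i p, j p)) set0 = 1.
  rewrite /sign_avg -[RHS](@avg_const R signs) ?card_ffun ?expn_gt0 ?card_bool //.
  by apply: eq_avg => tau; rewrite big_set0.
by rewrite !parity0 cards0 expr0 !mul1r !mulr1 addr0.
Qed.

Lemma mixture_null_gt0 z i j v u : 0 < mixture false z i j v u.
Proof.
rewrite mixture_null; apply: mulr_gt0.
  by rewrite invr_gt0 exprn_gt0 // mulr_gt0.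
by apply: mulr_gt0; exact: residual_gt0.
Qed.

Lemma sum_mixture_null (z : {ffun I -> Z}) :
  \sum_(i : {ffun I -> K}) \sum_(j : {ffun I -> K})
    \sum_(v : {ffun I -> bool}) \sum_(u : {ffun I -> bool}) mixture false z i j v u
  = n ^- #|I|.
Proof.
transitivity (\sum_(i : {ffun I -> K}) \sum_(j : {ffun I -> K})
    n ^- #|I| * residual R W z set0 i * residual R W z set0 j).
  apply: eq_bigr => i _; apply: eq_bigr => j _.
  transitivity (\sum_(v : {ffun I -> bool}) \sum_(u : {ffun I -> bool})
    (4 * n) ^- #|I| * (residual R W z set0 i * residual R W z set0 j)).
    by apply: eq_bigr => v _; apply: eq_bigr => u _; rewrite mixture_null.
  rewrite !sumr_const card_ffun card_bool -mulrnA -expnMn -[LHS]mulr_natr natrX.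
  set x := residual _ _ _ _ _; set y := residual _ _ _ _ _.
  by rewrite exprMn; field; rewrite !expf_neq0 // gt_eqF.
under eq_bigr => i _ do rewrite -mulr_sumr residual_sum // cards0 expr0 mulr1.
by rewrite -mulr_sumr residual_sum // cards0 expr0 mulr1.
Qed.

(** The null mixture does not depend on [u] and [v], and the difference is a sign-character series
    in [u], so Parseval turns its square into a sum of squared coefficients. *)
Lemma sum_mixture_diff (z : {ffun I -> Z}) :
  \sum_(i : {ffun I -> K}) \sum_(j : {ffun I -> K})
    \sum_(v : {ffun I -> bool}) \sum_(u : {ffun I -> bool})
     (mixture true z i j v u - mixture false z i j v u) ^+ 2
       / mixture false z i j v u
  = n ^- #|I| * \sum_(i : {ffun I -> K}) \sum_(j : {ffun I -> K})
     \sum_(B : {set I} | B != set0) sign_avg R (fun p => (z p, i p, j p)) B ^+ 2 *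
       (chi_weight R W z B i * chi_weight R W z B j).
Proof.
rewrite mulr_sumr; apply: eq_bigr => i _; rewrite mulr_sumr; apply: eq_bigr => j _.
pose x := residual R W z set0 i; pose y := residual R W z set0 j.
have x0 : 0 < x by exact: residual_gt0.
have y0 : 0 < y by exact: residual_gt0.
(* The coefficient at [set0] is zero because the empty terms of the two mixtures cancel. *)
pose a (B : {set I}) : R := if B == set0 then 0 else
  (4 * k ^+ 2) ^- #|B| * (sign_avg R (fun p => (z p, i p, j p)) B *
       residual R W z B i * residual R W z B j).
have diff v u : mixture true z i j v u - mixture false z i j v u =
    (4 * n) ^- #|I| * \sum_(B : {set I}) (a B * parity B v) * \prod_(p in B) sgn R (u p).
  rewrite !mixtureE -mulrBr -sumrB; congr (_ * _); apply: eq_bigr => B _.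
  rewrite /a; case: (eqVneq B set0) => [->|B0].
    by rewrite !cards0 !expr0 subrr !mul0r.
  rewrite mul0r expr0n cards_eq0 (negbTE B0) !mul0r subr0.
  by rewrite mul1r exprVn.
have N0 : (4 * n) ^+ #|I| != 0.
  by rewrite expf_neq0 // mulf_neq0 // gt_eqF.
transitivity ((4 * n) ^- #|I| / (x * y) * \sum_(v : {ffun I -> bool})
   (2 ^+ #|I| * \sum_(B : {set I}) a B ^+ 2)).
  rewrite mulr_sumr; apply: eq_bigr => v _.
  have -> : \sum_(B : {set I}) a B ^+ 2 = \sum_B (a B * parity B v) ^+ 2.
    apply: eq_bigr => B _; rewrite exprMn expr2 -[LHS]mulr1; congr (_ * _).
    by rewrite /parity expr2 -big_split big1 // => p _; exact: sgnK.
  rewrite -parseval mulr_sumr; apply: eq_bigr => u _.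
  rewrite diff mixture_null -/x -/y; set S := \sum_(B : {set I}) _.
  by field; rewrite N0 !gt_eqF.
rewrite sumr_const card_ffun card_bool -[X in _ * X = _]mulr_natr natrX.
have -> : (4 * n) ^- #|I| / (x * y) *
     (2 ^+ #|I| * (\sum_(B : {set I}) a B ^+ 2) * 2 ^+ #|I|)
   = n ^- #|I| * ((\sum_(B : {set I}) a B ^+ 2) / (x * y)).
  have -> : (4 * n) ^+ #|I| = 2 ^+ #|I| * 2 ^+ #|I| * n ^+ #|I|.
    have -> : 4 * n = 2 * 2 * n by ring.
    by rewrite !exprMn.
  have E0 : 2 ^+ #|I| != 0 :> R by rewrite expf_neq0 // pnatr_eq0.
  have nI0 : n ^+ #|I| != 0 by rewrite expf_neq0 // gt_eqF.
  move: (\sum_(B : {set I}) _) (2 ^+ #|I|) (n ^+ #|I|) E0 nI0 => S E N' E0 N0'.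
  by field; rewrite E0 N0' !gt_eqF.
congr (_ * _); rewrite mulr_suml (bigID (fun B => B == set0)) /=.
rewrite big1 ?add0r => [|B /eqP ->]; last by rewrite /a eqxx expr0n mul0r.
apply: eq_bigr => B B0; rewrite /a (negbTE B0) /chi_weight -/x -/y.
have -> : (4 * k ^+ 2) ^+ #|B| = (2 * k) ^+ (2 * #|B|).
  by rewrite exprM; congr (_ ^+ _); ring.
have E0 : (2 * k) ^+ (2 * #|B|) != 0 by rewrite expf_neq0 // gt_eqF // mulr_gt0.
move: (residual _ _ _ B i) (residual _ _ _ B j) (sign_avg _ _ _) (_ ^+ _) E0.
move=> b b' s E E0.
by field; rewrite E0 !gt_eqF.
Qed.

Definition balanced (T : nat) (z : {ffun I -> Z}) : bool :=
  [forall q, #|[set r | z r == q]| <= T]%N.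

(** Markov's inequality for 2 to the power of a slice's load. For a fixed slice this power sums to
    [(n + 1) ^+ #|I|], since each sample counts 2 in that slice and 1 in the others. *)
Lemma unbalanced_count (T : nat) :
  2 ^+ T * \sum_(z : {ffun I -> Z} | ~~ balanced T z) (1 : R)
  <= n * (n + 1) ^+ #|I|.
Proof.
apply: (@le_trans _ _ (\sum_(z : {ffun I -> Z}) \sum_q 2 ^+ #|[set r | z r == q]|)).
  rewrite mulr_sumr big_mkcond; apply: ler_sum => z _.
  case: ifP => [|_]; last by apply: sumr_ge0 => q _; exact: exprn_ge0.
  rewrite negb_forall => /existsP[q]; rewrite -ltnNge => hq.
  rewrite (bigD1 q) //= mulr1 -[leLHS]addr0; apply: lerD.
    by apply: ler_weXn2l; [rewrite ler1n|exact: ltnW].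
  by apply: sumr_ge0 => r _; exact: exprn_ge0.
rewrite exchange_big /=.
have -> : n * (n + 1) ^+ #|I| = \sum_(q : Z) (n + 1) ^+ #|I|.
  by rewrite sumr_const mulr_natl.
apply: ler_sum => q _; rewrite le_eqVlt; apply/orP; left; apply/eqP.
transitivity (\sum_(z : {ffun I -> Z}) \prod_r (if z r == q then 2 else 1 : R)).
  apply: eq_bigr => z _; rewrite -prodr_const big_mkcond; apply: eq_bigr => r _.
  by rewrite inE.
rewrite -(bigA_distr_bigA (fun r x => if x == q then 2 else 1 : R)) prodr_const.
congr (_ ^+ _).
transitivity (\sum_(x : Z) (1 + (x == q)%:R : R)).
  by apply: eq_bigr => x _; case: eqP => _; rewrite ?addr0 // -natr1.
rewrite big_split /= sumr_const (bigD1 q) //= eqxx big1 ?addr0 //.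
by move=> x /negbTE ->.
Qed.

(** Completing the square. It passes from chi-square to total variation without a square root; the
    first term sums to [8^-1] because the null mixture has mass 1. *)
Lemma ler_chi (a b : R) : 0 < b -> `|b - a| <= 8^-1 * b + 2 * ((a - b) ^+ 2 / b).
Proof.
move=> b0; rewrite -subr_ge0.
have -> : 8^-1 * b + 2 * ((a - b) ^+ 2 / b) - `|b - a| =
   2 * (`|b - a| - b / 4) ^+ 2 / b.
  rewrite [in LHS](_ : (a - b) ^+ 2 = `|b - a| ^+ 2); last first.
    by rewrite real_normK ?num_real // -sqrrN opprB.
  by field; rewrite gt_eqF.
by apply: divr_ge0; [rewrite mulr_ge0 ?sqr_ge0|exact: ltW].
Qed.

Lemma mixture_gap (T : nat)
    (A : {ffun I -> Z} -> {ffun I -> K} -> {ffun I -> K} ->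
         {ffun I -> bool} -> {ffun I -> bool} -> R) :
  (forall z i j v u, 0 <= A z i j v u <= 1) ->
  (forall z i j v u, 0 <= mixture true z i j v u) ->
  (2 * T <= #|W|)%N ->
  \sum_z \sum_i \sum_j \sum_v \sum_u
     (mixture false z i j v u - mixture true z i j v u) * A z i j v u
  <= n * (1 + n^-1) ^+ #|I| / 2 ^+ T + 8^-1 +
     2 * ((1 + (w / (2 * k ^+ 2)) ^+ 2) ^+ (#|I| * T) - 1).
Proof.
(* Unbalanced slice sequences are bounded by their null probability, balanced ones by the chi-square
   distance. *)
move=> hA mix0 hT; rewrite (bigID (balanced T)) /= addrC -addrA lerD //.
  apply: (@le_trans _ _ (\sum_(z : {ffun I -> Z} | ~~ balanced T z) n ^- #|I|)).
    apply: ler_sum => z _; rewrite -(sum_mixture_null z).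
    apply: ler_sum => i _; apply: ler_sum => j _.
    apply: ler_sum => v _; apply: ler_sum => u _.
    have /andP[A0 A1] := hA z i j v u; have h0 := mixture_null_gt0 z i j v u.
    have h1 := mix0 z i j v u; rewrite mulrBl lerBlDr.
    apply: (@le_trans _ _ (mixture false z i j v u)).
      by rewrite -[leRHS]mulr1; apply: ler_wpM2l => //; exact: ltW.
    by rewrite lerDl; exact: mulr_ge0.
  have := unbalanced_count T; set S := \sum_(z | _) _ => hS.
  have -> : \sum_(z : {ffun I -> Z} | ~~ balanced T z) n ^- #|I| = S * n ^- #|I|.
    by rewrite mulr_suml; apply: eq_bigr => z _; rewrite mul1r.
  have -> : 1 + n^-1 = (n + 1) / n by rewrite mulrDl divff ?gt_eqF // mul1r.
  rewrite exprMn exprVn mulrA mulrAC.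
  apply: ler_wpM2r; first by rewrite invr_ge0 exprn_ge0 // ltW.
  by rewrite ler_pdivlMr ?exprn_gt0 // mulrC.
set chi := (_ ^+ _ - 1).
have chi0 : 0 <= chi by rewrite subr_ge0 exprn_ege1 // lerDl sqr_ge0.
apply: (@le_trans _ _ (\sum_(z : {ffun I -> Z} | balanced T z)
   n ^- #|I| * (8^-1 + 2 * chi))).
  apply: ler_sum => z /forallP bz.
  have := @chi_square_bound R Z W K K0 W0 I z _ T bz.
  rewrite -/chi => /(_ (fun q => leq_trans (leq_mul (leqnn 2) (bz q)) hT)) hchi.
  apply: (@le_trans _ _ (\sum_(i : {ffun I -> K}) \sum_(j : {ffun I -> K})
    \sum_(v : {ffun I -> bool}) \sum_(u : {ffun I -> bool})
    (8^-1 * mixture false z i j v u +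
     2 * ((mixture true z i j v u - mixture false z i j v u) ^+ 2
       / mixture false z i j v u)))).
    apply: ler_sum => i _; apply: ler_sum => j _.
    apply: ler_sum => v _; apply: ler_sum => u _.
    apply: le_trans (ler_chi _ (mixture_null_gt0 z i j v u)).
    have /andP[A0 A1] := hA z i j v u.
    apply: le_trans (ler_norm _) _; rewrite normrM (ger0_norm A0).
    by rewrite -[leRHS]mulr1 ler_wpM2l.
  under eq_bigr => i _ do under eq_bigr => j _ do under eq_bigr => v _ do
    rewrite big_split /= -[X in X + _]mulr_sumr -[X in _ + X]mulr_sumr.
  under eq_bigr => i _ do under eq_bigr => j _ do
    rewrite big_split /= -[X in X + _]mulr_sumr -[X in _ + X]mulr_sumr.
  under eq_bigr => i _ do
    rewrite big_split /= -[X in X + _]mulr_sumr -[X in _ + X]mulr_sumr.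
  rewrite big_split /= -[X in X + _]mulr_sumr -[X in _ + X]mulr_sumr.
  rewrite sum_mixture_null sum_mixture_diff.
  rewrite mulrDr (mulrC 8^-1) lerD2l mulrCA ler_pM2l ?invr_gt0 ?exprn_gt0 //.
  by rewrite ler_pM2l.
rewrite -mulr_suml -[leRHS]mul1r.
apply: ler_wpM2r; first by apply: addr_ge0; [rewrite invr_ge0|exact: mulr_ge0].
apply: (@le_trans _ _ (\sum_(z : {ffun I -> Z}) n ^- #|I|)).
  rewrite big_mkcond; apply: ler_sum => z _; case: ifP => // _.
  by rewrite invr_ge0 exprn_ge0 // ltW.
rewrite sumr_const card_ffun -[X in X <= _]mulr_natr natrX mulVf //.
by rewrite expf_neq0 // gt_eqF.
Qed.

End Mixtures.

(** * Hard instances *)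

Section PushForward.
Variables (R : realType) (S T : finType) (f : S -> T) (d : distr R S).

Definition push_pmf (w : T) : R := \sum_(l | f l == w) d l.

Lemma push_ge0 w : 0 <= push_pmf w.
Proof. by apply: sumr_ge0 => l _; exact: pmf_ge0. Qed.

Lemma push_sum1 : \sum_w push_pmf w = 1.
Proof. by rewrite -(pmf_sum1 d) [RHS](partition_big f predT). Qed.

Definition push : distr R T := Distr push_ge0 push_sum1.

Lemma push_inj l : injective f -> push (f l) = d l.
Proof.
move=> fI; rewrite /= /push_pmf (big_pred1 l) // => l'.
exact: (inj_eq fI).
Qed.

(** Samples of the image law are images of latent samples: group the latent sequences by their
    image. *)
Lemma verdict_prob_push (m : nat) (D : tester R T m) b :
  verdict_prob D push b = \sum_(l : {ffun 'I_m -> S})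
    (\prod_k d (l k)) * D [tuple f (l k) | k < m] b.
Proof.
transitivity (\sum_(s : m.-tuple T) \sum_(l : {ffun 'I_m -> S} |
   s == [tuple f (l k) | k < m]) (\prod_k d (l k)) * D s b).
  apply: eq_bigr => s _; rewrite -mulr_suml; congr (_ * _).
  rewrite /= /push_pmf bigA_distr_big_dep; apply: eq_bigl => l.
  apply/familyP/eqP => [h|-> k].
    apply/eq_from_tnth => k; rewrite tnth_mktuple.
    by have := h k; rewrite unfold_in => /eqP.
  by rewrite unfold_in tnth_mktuple.
rewrite (exchange_big_dep predT) //=; apply: eq_bigr => l _.
by rewrite (big_pred1 [tuple f (l k) | k < m]).
Qed.

Lemma verdict_prob_push_sum (m : nat) (D : tester R T m) :
  verdict_prob D push true = 1 - verdict_prob D push false.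
Proof.
apply/eqP; rewrite eq_sym subr_eq eq_sym; apply/eqP.
rewrite !verdict_prob_push -big_split /=.
transitivity (\sum_(l : {ffun 'I_m -> S}) \prod_k d (l k)).
  apply: eq_bigr => l _; rewrite -mulrDr.
  have := pmf_sum1 (D [tuple f (l k) | k < m]); rewrite big_bool /= => ->.
  by rewrite mulr1.
rewrite -(bigA_distr_bigA (fun _ x => d x)) big1 // => k _; exact: pmf_sum1.
Qed.

End PushForward.

(** * Conditional independence as rank one slices *)

Section ConditionalIndependence.
Variables (R : realType) (X Y Z : finType).
Implicit Type p : distr R (X * Y * Z)%type.

Lemma cond_indep_prod p (f : X -> Z -> R) (g : Y -> Z -> R) :
  (forall x y z, p (x, y, z) = f x z * g y z) -> cond_indep p.
Proof.
move=> pE i j z.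
(* All events involved are rectangles inside slice [z], whose probabilities factor. *)
have slice (P : pred X) (Q : pred Y) (A : pred (X * Y * Z)) :
    (forall x y z', A (x, y, z') = [&& P x, Q y & z' == z]) ->
    Pr p A = (\sum_(x | P x) f x z) * (\sum_(y | Q y) g y z).
  move=> AE; rewrite /Pr big_distrlr /= pair_big /=.
  rewrite (reindex_onto (fun xy => (xy, z)) fst) /=; last first.
    by move=> [[x y] z']; rewrite AE => /and3P[_ _ /eqP ->].
  by apply: eq_big => -[x y] /=; rewrite ?pE // AE !eqxx !andbT.
rewrite /condPr (slice predT predT) => [|//].
rewrite (slice (pred1 i) (pred1 j)) => [|x y z' /=]; last by rewrite -andbA.
rewrite (slice (pred1 i) predT) => [|x y z' //=].
rewrite (slice predT (pred1 j)) => [|x y z' //=].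
rewrite !big_pred1_eq; set F := \sum_x _; set G := \sum_y _ => FG.
have FG0 : F * G != 0 by rewrite gt_eqF.
have /andP[F0 G0] : (F != 0) && (G != 0) by move: FG0; rewrite mulf_eq0 negb_or.
by field; rewrite F0 G0.
Qed.

Lemma cond_indep_minor p x x' y y' z : cond_indep p ->
  p (x, y, z) * p (x', y', z) = p (x, y', z) * p (x', y, z).
Proof.
move=> pci; set P := Pr p [pred w | w.2 == z].
have P0 : 0 <= P by apply: sumr_ge0 => w _; exact: pmf_ge0.
(* [cond_indep] is silent about a slice of probability zero, but there all entries vanish. *)
have [Pz|Pz] := eqVneq P 0.
  have p0 x1 y1 : p (x1, y1, z) = 0.
    by apply: (psumr_eq0P _ Pz) => [w _|]; [exact: pmf_ge0|rewrite /= eqxx].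
  by rewrite !p0.
have Pgt : 0 < P by rewrite lt_def Pz.
have pE x1 y1 : p (x1, y1, z) = P *
    (condPr p [pred w | w.1.1 == x1] [pred w | w.2 == z] *
     condPr p [pred w | w.1.2 == y1] [pred w | w.2 == z]).
  by rewrite -pci // /condPr mulrC divfK // /Pr (big_pred1 (x1, y1, z)).
rewrite !pE; ring.
Qed.

End ConditionalIndependence.

(** By symmetry [a] is the smaller of [a] and [d]; then [b * c] is at least [a ^+ 2], so [b + c] is
    at least [2 * a]. Either [a] is at most [be], hence [al] below its target, or [b] and [c]
    overshoot [be] enough to compensate. *)
Lemma minor_dist (R : realFieldType) (al be a b c d : R) :
  0 <= a -> 0 <= b -> 0 <= c -> 0 <= d -> a * d = b * c ->
  al <= `|al + be - a| + `|be - b| + `|be - c| + `|al + be - d|.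
Proof.
wlog ad : a d / a <= d => [wlog a0 b0 c0 d0 adbc|a0 b0 c0 d0 adbc].
  have [ad|/ltW da] := leP a d; first exact: wlog.
  by have := wlog d a da d0 b0 c0 a0; rewrite mulrC => /(_ adbc); lra.
have bc : 2 * a <= b + c.
  rewrite -(@ler_pXn2r _ 2) ?nnegrE ?addr_ge0 ?mulr_ge0 //.
  have h : a * a <= b * c by rewrite -adbc ler_wpM2l.
  by have := sqr_ge0 (b - c); nra.
have h1 := ler_norm (al + be - a); have h2 := ler_norm (b - be).
have h3 := ler_norm (c - be); rewrite distrC in h2; rewrite distrC in h3.
have h4 := normr_ge0 (al + be - d); have h5 := normr_ge0 (be - b).
have h6 := normr_ge0 (be - c).
by have [ab|ba] := leP be a; lra.
Qed.

(** * Instances on the sample space and Le Cam's method *)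

Section Instances.
Variables (R : realType) (X Y Z W K : finType).
Variables (eX : K * bool -> X) (eY : K * bool -> Y).
Hypotheses (eXI : injective eX) (eYI : injective eY).
Hypotheses (K0 : (0 < #|K|)%N) (W0 : (0 < #|W|)%N) (Z0 : (0 < #|Z|)%N).

Local Notation k := (#|K|%:R : R).
Local Notation n := (#|Z|%:R : R).
Local Notation heavy := {ffun Z * W -> K}.
Local Notation signs := {ffun Z * K * K -> bool}.
Local Notation latent := ((K * bool) * (K * bool) * Z)%type.

Let k0 : 0 < k. Proof. by rewrite ltr0n. Qed.
Let n0 : 0 < n. Proof. by rewrite ltr0n. Qed.

Section OneInstance.
Variables (beta : bool) (phi psi : heavy) (tau : signs).

(** The sign term has size [(4 * k ^+ 2)^-1], the product of the two light parts, so it never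
    exceeds the product of the marginals. *)
Lemma inst_ge0 l : 0 <= inst R beta phi psi tau l.
Proof.
case: l => -[[i u] [j v]] z; rewrite /inst /=.
apply: mulr_ge0; first by rewrite invr_ge0 mulr_ge0 // ltW.
have kk : 0 < (4 * k ^+ 2)^-1 by rewrite invr_gt0 mulr_gt0 // exprn_gt0.
have : (4 * k ^+ 2)^-1 <= marg R phi z i * marg R psi z j.
  have -> : (4 * k ^+ 2)^-1 = (2 * k)^-1 * (2 * k)^-1.
    by field; rewrite gt_eqF.
  by apply: ler_pM; rewrite ?marg_ge // invr_ge0 mulr_ge0 // ltW.
move: (marg R phi z i * _) => mm.
by case: beta; case: u; case: v; case: (tau _);
  rewrite /sgn ?expr1 ?expr0 /=; lra.
Qed.

Lemma inst_sum1 : \sum_l inst R beta phi psi tau l = 1.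
Proof.
rewrite sum_latent.
transitivity (\sum_(z : Z) \sum_i \sum_j n^-1 * (marg R phi z i * marg R psi z j)).
  apply: eq_bigr => z _; apply: eq_bigr => i _; apply: eq_bigr => j _.
  rewrite !big_bool /= /inst /=; set mm := marg R phi z i * _.
  case: (tau _); rewrite /sgn ?expr1 ?expr0; field.
  - by rewrite !gt_eqF.
  - by rewrite !gt_eqF.
transitivity (\sum_(z : Z) n^-1); last first.
  by rewrite sumr_const -[X in X = _]mulr_natr mulVf // gt_eqF.
apply: eq_bigr => z _.
under eq_bigr => i _ do rewrite -mulr_sumr -mulr_sumr marg_sum // mulr1.
by rewrite -mulr_sumr marg_sum // mulr1.
Qed.

Definition inst_distr : distr R latent := Distr inst_ge0 inst_sum1.

Definition embed (l : latent) : X * Y * Z := ((eX l.1.1, eY l.1.2), l.2).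

Lemma embed_inj : injective embed.
Proof. by move=> [[a b] z] [[a' b'] z'] [/eXI -> /eYI -> ->]. Qed.

(** Points outside the images of [eX] and [eY] get mass zero, which takes care of odd domain
    sizes. *)
Definition hard : distr R (X * Y * Z)%type := push embed inst_distr.

End OneInstance.

Lemma hard_cond_indep phi psi tau : cond_indep (hard false phi psi tau).
Proof.
apply: (@cond_indep_prod _ _ _ _ _
  (fun x z => \sum_(a | eX a == x) (4 * n)^-1 * marg R phi z a.1)
  (fun y z => \sum_(b | eY b == y) marg R psi z b.1)) => x y z.
rewrite /= /push_pmf big_distrlr /= pair_big /=.
rewrite (reindex_onto (fun ab => (ab, z)) fst) /=; last first.
  by move=> [[a b] z'] /eqP[_ _ ->].
apply: eq_big => -[a b] /=; first by rewrite !xpair_eqE !eqxx !andbT.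
by move=> _; rewrite /inst /= !mul0r add0r mulrA.
Qed.

(* Each block of [hard true] is a diagonal (or an antidiagonal) added to a
   constant, hence far from every matrix of rank one. *)
Lemma hard_far phi psi tau (q : distr R (X * Y * Z)%type) :
  cond_indep q -> 16^-1 <= dTV (hard true phi psi tau) q.
Proof.
move=> qci; rewrite /dTV.
apply: (@le_trans _ _ (2^-1 * \sum_l `|inst R true phi psi tau l - q (embed l)|));
    last first.
  apply: ler_wpM2l; first by rewrite invr_ge0.
  under eq_bigr => l _ do
    rewrite -[inst _ _ _ _ _ l]/(inst_distr true phi psi tau l)
      -(push_inj (inst_distr true phi psi tau) l embed_inj).
  exact: (sum_inj (F := fun w => `|hard true phi psi tau w - q w|) embed_inj).
rewrite sum_latent.
(* Each of the [n * k ^+ 2] blocks contributes at least [(8 * n * k ^+ 2)^-1] to the sum, giving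
   [16^-1] after halving. *)
apply: (@le_trans _ _ (2^-1 *
  \sum_(z : Z) \sum_(i : K) \sum_(j : K) (8 * n * k ^+ 2)^-1)).
  have cst (S : finType) (x : R) : \sum_(s : S) x = #|S|%:R * x.
    by rewrite sumr_const mulr_natl.
  rewrite !cst le_eqVlt; apply/orP; left; apply/eqP.
  by field; rewrite !gt_eqF.
apply: ler_wpM2l; first by rewrite invr_ge0.
apply: ler_sum => z _; apply: ler_sum => i _; apply: ler_sum => j _.
have q0 u v : 0 <= q (embed ((i, u), (j, v), z)) by exact: pmf_ge0.
have minor := cond_indep_minor (eX (i, true)) (eX (i, false))
  (eY (j, true)) (eY (j, false)) z qci.
rewrite !big_bool /inst /=.
move: minor (q0 true true) (q0 true false) (q0 false true) (q0 false false).
rewrite /embed /=; move: (q _) (q _) (q _) (q _) => c b d a adbc a0 b0 c0 d0.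
set mm := marg R phi z i * _.
have al : (8 * n * k ^+ 2)^-1 = (4 * n)^-1 * (2 / (4 * k ^+ 2)).
  by field; rewrite !gt_eqF.
pose be := (4 * n)^-1 * (mm - (4 * k ^+ 2)^-1).
rewrite al; case: (tau _); rewrite /sgn ?expr1 ?expr0.
(* A negative sign puts the larger entries on the antidiagonal, so the entries of [q] are permuted
   accordingly. *)
- have := @minor_dist R ((4 * n)^-1 * (2 / (4 * k ^+ 2))) be b a d c.
  move=> /(_ b0 a0 d0 c0 (esym adbc)) h; apply: le_trans h _.
  have -> : (4 * n)^-1 * (2 / (4 * k ^+ 2)) + be = (4 * n)^-1 * (mm + (4 * k ^+ 2)^-1).
    by rewrite /be; ring.
  rewrite /be; set A := (4 * n)^-1; set B := (4 * k ^+ 2)^-1.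
  have -> : A * (1 * B * (-1 * (-1 * -1)) + mm) = A * (mm - B) by ring.
  have -> : A * (1 * B * (1 * (1 * -1)) + mm) = A * (mm - B) by ring.
  have -> : A * (1 * B * (-1 * (1 * -1)) + mm) = A * (mm + B) by ring.
  have -> : A * (1 * B * (1 * (-1 * -1)) + mm) = A * (mm + B) by ring.
  lra.
- have := @minor_dist R ((4 * n)^-1 * (2 / (4 * k ^+ 2))) be a b c d.
  move=> /(_ a0 b0 c0 d0 adbc) h; apply: le_trans h _.
  have -> : (4 * n)^-1 * (2 / (4 * k ^+ 2)) + be = (4 * n)^-1 * (mm + (4 * k ^+ 2)^-1).
    by rewrite /be; ring.
  rewrite /be; set A := (4 * n)^-1; set B := (4 * k ^+ 2)^-1.
  have -> : A * (1 * B * (-1 * (-1 * 1)) + mm) = A * (mm + B) by ring.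
  have -> : A * (1 * B * (1 * (1 * 1)) + mm) = A * (mm + B) by ring.
  have -> : A * (1 * B * (-1 * (1 * 1)) + mm) = A * (mm - B) by ring.
  have -> : A * (1 * B * (1 * (-1 * 1)) + mm) = A * (mm - B) by ring.
  lra.
Qed.

Lemma hard_dTV_set phi psi tau :
  1 / 20 <= dTV_set (hard true phi psi tau) (@CI R X Y Z).
Proof.
apply: lb_le_inf.
  (* The lower bound on [inf] requires a nonempty set of distances. *)
  exists (dTV (hard true phi psi tau) (hard false phi psi tau)).
  by exists (hard false phi psi tau) => //; exact: hard_cond_indep.
move=> _ [q qci <-]; apply: le_trans (hard_far phi psi tau qci).
by lra.
Qed.

Lemma avg_verdict (m : nat) (D : tester R (X * Y * Z)%type m) beta b :
  avg (fun phi : heavy => avg (fun psi : heavy => avg (fun tau : signs =>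
    verdict_prob D (hard beta phi psi tau) b))) =
  \sum_(z : {ffun 'I_m -> Z}) \sum_(i : {ffun 'I_m -> K})
    \sum_(j : {ffun 'I_m -> K}) \sum_(v : {ffun 'I_m -> bool})
    \sum_(u : {ffun 'I_m -> bool}) mixture R W beta z i j v u *
    D [tuple embed ((i p, u p), (j p, v p), z p) | p < m] b.
Proof.
pose e (l : {ffun 'I_m -> latent}) := D [tuple embed (l p) | p < m] b.
transitivity (\sum_(l : {ffun 'I_m -> latent}) e l *
   avg (fun phi : heavy => avg (fun psi : heavy => avg (fun tau : signs =>
     \prod_p inst R beta phi psi tau (l p))))).
  transitivity (avg (fun phi : heavy => \sum_(l : {ffun 'I_m -> latent}) e l *
     avg (fun psi : heavy => avg (fun tau : signs =>
       \prod_p inst R beta phi psi tau (l p))))); last first.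
    by rewrite avg_sum; apply: eq_bigr => l _; rewrite avgZ.
  apply: eq_avg => phi.
  transitivity (avg (fun psi : heavy => \sum_(l : {ffun 'I_m -> latent}) e l *
     avg (fun tau : signs => \prod_p inst R beta phi psi tau (l p)))); last first.
    by rewrite avg_sum; apply: eq_bigr => l _; rewrite avgZ.
  apply: eq_avg => psi.
  transitivity (avg (fun tau : signs => \sum_(l : {ffun 'I_m -> latent}) e l *
     \prod_p inst R beta phi psi tau (l p))); last first.
    by rewrite avg_sum; apply: eq_bigr => l _; rewrite avgZ.
  apply: eq_avg => tau; rewrite verdict_prob_push.
  by apply: eq_bigr => l _; rewrite mulrC.
rewrite sum_latent_ffun; do 5!(apply: eq_bigr => ? _).
rewrite mulrC; congr (_ * _).
  apply: eq_avg => phi; apply: eq_avg => psi; apply: eq_avg => tau.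
  by apply: eq_bigr => p _; rewrite ffunE.
by rewrite /e; congr (D _ _); apply: eq_from_tnth => p; rewrite !tnth_mktuple ffunE.
Qed.

(** Le Cam's method: averaged over the random instances, a correct tester accepts the two mixtures
    with probabilities at least [1 / 3] apart, and [mixture_gap] bounds this difference. *)
Lemma tester_bound (m T : nat) (D : tester R (X * Y * Z)%type m) :
  solves_CI_testing (1 / 20) D -> (2 * T <= #|W|)%N ->
  3^-1 <= n * (1 + n^-1) ^+ m / 2 ^+ T + 8^-1 +
    2 * ((1 + (#|W|%:R / (2 * k ^+ 2)) ^+ 2) ^+ (m * T) - 1).
Proof.
move=> Dok hT.
have heavy0 : (0 < #|{: heavy}|)%N by rewrite card_ffun expn_gt0 K0.
have signs0 : (0 < #|{: signs}|)%N by rewrite card_ffun expn_gt0 card_bool.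
have avg3 (c : R) : avg (fun phi : heavy => avg (fun psi : heavy =>
    avg (fun tau : signs => c))) = c.
  by rewrite !avg_const.
have accept : 2 / 3 <= avg (fun phi : heavy => avg (fun psi : heavy =>
    avg (fun tau : signs => verdict_prob D (hard false phi psi tau) true))).
  rewrite -[leLHS]avg3; apply: le_avg => phi; apply: le_avg => psi.
  by apply: le_avg => tau; apply: (Dok _).1; exact: hard_cond_indep.
have reject : avg (fun phi : heavy => avg (fun psi : heavy =>
    avg (fun tau : signs => verdict_prob D (hard true phi psi tau) true))) <= 1 / 3.
  rewrite -[leRHS]avg3; apply: le_avg => phi; apply: le_avg => psi.
  apply: le_avg => tau; rewrite verdict_prob_push_sum.
  by have := (Dok (hard true phi psi tau)).2 (hard_dTV_set phi psi tau); lra.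
pose A (z : {ffun 'I_m -> Z}) (i j : {ffun 'I_m -> K}) (v u : {ffun 'I_m -> bool}) :=
  D [tuple embed ((i p, u p), (j p, v p), z p) | p < m] true.
have A01 z i j v u : 0 <= A z i j v u <= 1.
  rewrite /A; move: (D _) => d; rewrite pmf_ge0 -(pmf_sum1 d) big_bool /= lerDl.
  exact: pmf_ge0.
have mix0 z i j v u : 0 <= @mixture R Z W K 'I_m true z i j v u.
  apply: avg_ge0 => phi; apply: avg_ge0 => psi; apply: avg_ge0 => tau.
  by apply: prodr_ge0 => p _; exact: inst_ge0.
have := mixture_gap K0 W0 Z0 A01 mix0 hT; rewrite card_ord => gap.
apply: le_trans gap.
apply: (@le_trans _ _ (2 / 3 - 1 / 3)); first by lra.
apply: le_trans (lerB accept reject) _; rewrite !avg_verdict.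
rewrite le_eqVlt; apply/orP; left; apply/eqP.
do 5!(rewrite -sumrB; apply: eq_bigr => ? _).
by rewrite mulrBl.
Qed.

End Instances.

(** * Choice of the parameters *)

Lemma sqr_le_expn2 q : (11 <= q)%N -> (16 * q ^ 2 <= 2 ^ q)%N.
Proof.
elim: q => // q IH; rewrite leq_eqVlt => /orP[/eqP [<-] //|q11].
by have := IH q11; rewrite -!mulnn expnS; move: (2 ^ q)%N => e; nia.
Qed.

Lemma half_bounds n : (1 < n)%N ->
  [/\ (0 < n./2)%N, (n <= 3 * n./2)%N & (n./2 * 2 <= n)%N].
Proof. by move=> n1; split; lia. Qed.

(** With [Q <= 2 * r] and [r ^+ 4 = n ^+ 3] the left side is at most [64 * c * n ^+ 4], hence at
    most [64 * 81 * c * k ^+ 4]; and [64 * 81 * 40] is below [480 * 480]. *)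
Lemma sample_size_bound (R : realFieldType) (c n r Q M k : R) :
  480 * 480 * c <= 1 -> 0 <= c -> 1 <= r -> 0 <= n -> 0 <= Q -> 0 <= M ->
  r ^+ 4 = n ^+ 3 -> n <= 3 * k -> Q <= r + 1 -> M <= c * (n * r) ->
  8 * M * Q ^+ 3 <= 40^-1 * k ^+ 4.
Proof.
move=> c1 c0 r1 n0 Q0 M0 r4 nk Qr MM.
have r0 : 0 <= r by lra.
have k0 : 0 <= k by lra.
have Q3 : Q ^+ 3 <= (2 * r) ^+ 3.
  by rewrite ler_pXn2r ?nnegrE ?mulr_ge0 //; lra.
have n4 : n ^+ 4 <= (3 * k) ^+ 4 by rewrite ler_pXn2r ?nnegrE ?mulr_ge0.
have : M * Q ^+ 3 <= c * (n * r) * (2 * r) ^+ 3.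
  by apply: ler_pM => //; rewrite exprn_ge0.
have -> : c * (n * r) * (2 * r) ^+ 3 = 8 * (c * (n * r ^+ 4)) by ring.
have : 480 * 480 * c * n ^+ 4 <= 1 * n ^+ 4.
  by apply: ler_wpM2r => //; rewrite exprn_ge0.
have k4 : 0 <= k ^+ 4 by rewrite exprn_ge0.
rewrite r4 -exprS; move: n4 k4; rewrite exprMn.
by move: (n ^+ 4) (k ^+ 4) (Q ^+ 3) => n4 k4 Q4; lra.
Qed.

Lemma gap_lt (R : realFieldType) (a E x : R) :
  a <= 16^-1 -> x <= 40^-1 -> 0 <= E -> E * (1 - x) <= 1 ->
  a + 8^-1 + 2 * (E - 1) < 3^-1.
Proof.
move=> ha hx E0 hE.
have : E * (1 - 40^-1) <= E * (1 - x) by rewrite ler_wpM2l //; lra.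
by lra.
Qed.

Theorem theorem1p5 (R : realType) :
  exists2 c : R, 0 < c &
  exists N : nat, forall n : nat, (N <= n)%N ->
  forall X Y Z : finType, #|X| = n -> #|Y| = n -> #|Z| = n ->
  forall (m : nat) (D : tester R (X * Y * Z)%type m),
    solves_CI_testing (1 / 20) D ->
    c * (n%:R `^ (7 / 4)) <= m%:R.
Proof.
pose c : R := 480^-1 * 480^-1.
have cle : 480 * 480 * c <= 1 by rewrite /c; lra.
have c_gt0 : 0 < c by rewrite mulr_gt0 ?invr_gt0.
move: c cle c_gt0 => c cle c_gt0.
exists c => //.
exists 100%N => n n100 X Y Z cX cY cZ m D Dok.
rewrite leNgt; apply/negP => mlt.
(* Working with [r] leaves only integer powers: the target is [n * r], and [r ^+ 4 = n ^+ 3]. *)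
pose r : R := n%:R `^ (3 / 4).
have n0 : (0 : R) < n%:R by rewrite ltr0n (leq_trans _ n100).
have r0 : 0 <= r by exact: powR_ge0.
have nr : n%:R `^ (7 / 4) = n%:R * r.
  rewrite /r -{2}[n%:R]powRr1 ?ltW // -powRD; last by rewrite (gt_eqF n0) implybT.
  by congr (_ `^ _); field.
have r4 : r ^+ 4 = n%:R ^+ 3.
  rewrite -powR_mulrn // /r -powRrM -powR_mulrn ?ltW //.
  by congr (_ `^ _); field.
have n100R : (100 : R) <= n%:R by rewrite ler_nat.
have r11 : 11 <= r.
  rewrite -(@ler_pXn2r _ 4) ?nnegrE // r4.
  apply: (@le_trans _ _ (100 ^+ 3)); first by lra.
  by rewrite ler_pXn2r ?nnegrE ?(ltW n0).
have nr2 : n%:R <= r ^+ 2.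
  rewrite -(@ler_pXn2r _ 2) ?nnegrE ?sqr_ge0 ?(ltW n0) // -exprM r4.
  by apply: ler_weXn2l => //; lra.
(* The integer scale for heavy slots, with [r < q <= r + 1]: each slice gets [4 * q] slots and the
   load bound is [T = 2 * q], exactly half of them. *)
pose q := (Num.truncn r).+1.
have /andP[q1 q2] : (q%:R <= r + 1) && (r < q%:R).
  by have /andP[] := truncn_itv r0; rewrite /q -natr1 lerD2r => -> ->.
have q11 : (11 <= q)%N by rewrite -(ler_nat R) (le_trans r11) // ltW.
have [] := half_bounds (leq_trans (isT : (1 < 100)%N) n100).
set k := n./2 => k0 k3 k2.
have [eX eXI] : exists f : 'I_k * bool -> X, injective f.
  by apply: inj_of_card; rewrite card_prod card_ord card_bool cX.
have [eY eYI] : exists f : 'I_k * bool -> Y, injective f.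
  by apply: inj_of_card; rewrite card_prod card_ord card_bool cY.
have W0 : (0 < #|'I_(4 * q)|)%N by rewrite card_ord.
have K0 : (0 < #|'I_k|)%N by rewrite card_ord.
have Z0 : (0 < #|Z|)%N by rewrite cZ (leq_trans _ n100).
have := tester_bound eXI eYI K0 W0 Z0 (T := 2 * q) Dok.
rewrite !card_ord cZ mulnA => /(_ (leqnn _)); apply/negP; rewrite -ltNge.
have k3R : n%:R <= 3 * k%:R :> R by rewrite -natrM ler_nat.
have kR : (0 : R) < k%:R by rewrite ltr0n.
have qR : (0 : R) < q%:R by rewrite ltr0n.
have mkq : (m <= k * q)%N.
  rewrite -(ler_nat R) natrM (le_trans (ltW mlt)) // nr mulrA.
  apply: ler_pM => //; rewrite ?(ltW q2) ?mulr_ge0 ?(ltW c_gt0) ?(ltW n0) //.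
  apply: (@le_trans _ _ (3^-1 * n%:R)); last by lra.
  by apply: ler_wpM2r; [exact: ltW|lra].
have first : n%:R * (1 + n%:R^-1) ^+ m / 2 ^+ (2 * q) <= 16^-1 :> R.
  (* Since [m <= k * q] and [k / n <= 1 / 2], each block of [k] factors is at most 2. Of
     [2 ^+ (2 * q)], one half of the exponent absorbs this power and the other absorbs [16 * n]. *)
  have b2 : (1 + n%:R^-1) ^+ m <= 2 ^+ q :> R.
    apply: (@le_trans _ _ ((1 + n%:R^-1) ^+ (k * q))).
      by rewrite ler_weXn2l // lerDl invr_ge0 ltW.
    rewrite exprM lerXn2r ?nnegrE ?exprn_ge0 ?addr_ge0 ?invr_ge0 ?(ltW n0) //.
    have := @bernoulli_inv R n%:R^-1 k; rewrite invr_ge0 => /(_ (ltW n0)).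
    have hk : n%:R^-1 * k%:R <= 2^-1 :> R.
      by rewrite ler_pdivrMl // ler_pdivlMr // -natrM ler_nat.
    set e := _ ^+ k => he; have e0 : 0 <= e.
      by rewrite exprn_ge0 // addr_ge0 // invr_ge0 ltW.
    have : e * 2^-1 <= e * (1 - n%:R^-1 * k%:R) by rewrite ler_wpM2l //; lra.
    by lra.
  have nq : 16 * n%:R <= 2 ^+ q :> R.
    rewrite -natrX (le_trans _ (_ : (16 * q ^ 2)%:R <= _)) ?ler_nat ?sqr_le_expn2 //.
    rewrite natrM ler_pM2l // (le_trans nr2) // natrX.
    by rewrite ler_pXn2r ?nnegrE ?(ltW q2).
  have E0 : 0 < 2 ^+ q :> R by rewrite exprn_gt0.
  rewrite mulnC exprM expr2 ler_pdivrMr ?mulr_gt0 //.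
  move: (2 ^+ q) (_ ^+ m) b2 nq E0 => E F FE nE E0; nra.
set d := (_ / _) ^+ 2.
have dE : d = 4 * q%:R ^+ 2 / k%:R ^+ 4.
  by rewrite /d natrM; field; rewrite gt_eqF.
have dN : d * (m * (2 * q))%:R <= 40^-1.
  rewrite dE !natrM; set M := m%:R; set Q := q%:R; set k' := k%:R.
  have -> : 4 * Q ^+ 2 / k' ^+ 4 * (M * (2 * Q)) = 8 * M * Q ^+ 3 / k' ^+ 4.
    by field; rewrite gt_eqF.
  rewrite ler_pdivrMr ?exprn_gt0 //.
  apply: (sample_size_bound cle (ltW c_gt0) _ (ltW n0) _ _ r4 k3R q1) => //.
  - by apply: le_trans r11; rewrite ler1n.
  - by rewrite -nr ltW.
have d0 : 0 <= d by rewrite sqr_ge0.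
apply: gap_lt first dN _ (bernoulli_inv _ d0).
by rewrite exprn_ge0 // addr_ge0.
Qed.
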